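(* (i) $\mathrm{MC}(\cap,+,/)\in\mathrm{P}$. (ii) $\mathrm{MC}(\cap,+,\times,/)\in\mathrm{E}$, where $\mathrm{E}=\mathrm{DTIME}(2^{O(n)})$.
   Context: Natural numbers include $0$. For $A,B\subseteq\mathbb N$: $A\cup B$, $A\cap B$ are the usual operations, $\overline{A}=\mathbb N\setminus A$, $A+B=\{a+b: a\in A, b\in B\}$, $A\times B=\{a\cdot b: a\in A, b\in B\}$, and $A/B=\{c\in\mathbb N:\exists a\in A\ \exists b\in B\setminus\{0\}: a=c\cdot b\}$ (exact integer division without remainder or rounding). For $\emptyset\ne\mathcal O\subseteq\{\cup,\cap,\overline{\phantom{c}},+,\times,/\}$, an $\mathcal O$-circuit $C=(V,E,g_C,\alpha)$ is a finite acyclic directed multigraph with gate set $V\subseteq\mathbb N$, every gate having indegree $0$, $1$ or $2$, a designated output gate $g_C\in V$, and a labeling $\alpha$: gates of indegree $0$ (input gates) are labeled by natural numbers, gates of indegree $1$ are labeled $\overline{\phantom{c}}$ (allowed only if $\overline{\phantom{c}}\in\mathcal O$), and gates of indegree $2$ are labeled by an operation in $\mathcal O\setminus\{\overline{\phantom{c}}\}$. The result set $I(g)\subseteq\mathbb N$ is defined inductively: $I(g)=\{\alpha(g)\}$ for an input gate; $I(g)=\mathbb N\setminus I(p)$ for a complement gate with predecessor $p$; $I(g)=I(g_1)\,\sigma\,I(g_2)$ for a gate labeled $\sigma$ with predecessors $g_1\le g_2$ (a double edge from one gate gives $g_1=g_2$). $I(C)=I(g_C)$. A circuit is encoded as a bit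 string listing its gates in reverse topological order, each gate as the triple (gate name, label, list of predecessors), with all numbers (including input labels) in binary; $|C|$ denotes the length of this encoding. The membership problem is $\mathrm{MC}(\mathcal O)=\{(C,b): C \text{ is an } \mathcal O\text{-circuit},\ b\in\mathbb N,\ b\in I(C)\}$, with $b$ given in binary; $\mathrm{MC}(\sigma_1,\dots,\sigma_n)$ abbreviates $\mathrm{MC}(\{\sigma_1,\dots,\sigma_n\})$. *)

(* Defs.v *)
From mathcomp Require Import all_boot.
Set Implicit Arguments. Unset Strict Implicit. Unset Printing Implicit Defensive.

Inductive op := OCup | OCap | OCompl | OPlus | OTimes | ODiv.

Inductive label := LIn of nat | LOp of op.

Record gate := Gate { g_name : nat; g_label : label; g_preds : seq nat }.

(* A circuit: its gates listed in reverse topological order (every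
   predecessor of a gate occurs later in the list) and its output gate. *)
Record circuit := Circuit { c_gates : seq gate; c_out : nat }.

Definition nset := nat -> Prop.

Definition set_cup (A B : nset) : nset := fun x => A x \/ B x.
Definition set_cap (A B : nset) : nset := fun x => A x /\ B x.
Definition set_compl (A : nset) : nset := fun x => ~ A x.
Definition set_plus (A B : nset) : nset :=
  fun x => exists a b, A a /\ B b /\ x = a + b.
Definition set_times (A B : nset) : nset :=
  fun x => exists a b, A a /\ B b /\ x = a * b.
Definition set_div (A B : nset) : nset :=
  fun c => exists a b, A a /\ B b /\ b <> 0 /\ a = c * b.

Definition binop_sem (o : op) : nset -> nset -> nset :=
  match o with
  | OCup => set_cup | OCap => set_cap | OPlus => set_plus
  | OTimes => set_times | ODiv => set_div
  | OCompl => fun _ _ _ => False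
  end.

Definition gate_val (S : nat -> nset) (g : gate) : nset :=
  match g_label g with
  | LIn a => fun x => x = a
  | LOp OCompl =>
      match g_preds g with [:: p] => set_compl (S p) | _ => fun _ => False end
  | LOp o =>
      match g_preds g with
      | [:: p; q] => binop_sem o (S (minn p q)) (S (maxn p q))
      | _ => fun _ => False end
  end.

Fixpoint sem (l : seq gate) (n : nat) : nset :=
  match l with
  | [::] => fun _ => False
  | g :: r => if g_name g == n then gate_val (sem r) g else sem r n
  end.

Definition I_C (C : circuit) : nset := sem (c_gates C) (c_out C).

Definition gate_ok (O : op -> Prop) (g : gate) (later : seq gate) : Prop :=
  (forall p, p \in g_preds g -> p \in map g_name later) /\
  match g_label g with
  | LIn _ => g_preds g = [::]
  | LOp OCompl => O OCompl /\ size (g_preds g) = 1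
  | LOp o => O o /\ size (g_preds g) = 2
  end.

Fixpoint gates_ok (O : op -> Prop) (l : seq gate) : Prop :=
  match l with
  | [::] => True
  | g :: r => gate_ok O g r /\ gates_ok O r
  end.

(* C is an O-circuit (gate names distinct, acyclic via the reverse
   topological listing, indegrees match labels, labels in O) *)
Definition valid_circuit (O : op -> Prop) (C : circuit) : Prop :=
  uniq (map g_name (c_gates C)) /\ c_out C \in map g_name (c_gates C) /\
  gates_ok O (c_gates C).

(* binary representation, most significant bit first, 0 written as "0" *)
Fixpoint binr (f n : nat) : seq bool :=
  match f with
  | 0 => [::]
  | f'.+1 => if n < 2 then [:: n == 1] else odd n :: binr f' n./2
  end.
Definition bin (n : nat) : seq bool := rev (binr n.+1 n).

Inductive esym := E0 | E1 | ESep | EGate | EIn | EOp of op.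

Definition esym_code (s : esym) : seq bool :=
  match s with
  | E0 => [:: false; false; false; false]
  | E1 => [:: false; false; false; true]
  | ESep => [:: false; false; true; false]
  | EGate => [:: false; false; true; true]
  | EIn => [:: false; true; false; false]
  | EOp OCup => [:: false; true; false; true]
  | EOp OCap => [:: false; true; true; false]
  | EOp OCompl => [:: false; true; true; true]
  | EOp OPlus => [:: true; false; false; false]
  | EOp OTimes => [:: true; false; false; true]
  | EOp ODiv => [:: true; false; true; false]
  end.

Definition enum_syms (n : nat) : seq esym := map (fun b => if b then E1 else E0) (bin n).

Definition label_syms (l : label) : seq esym :=
  match l with LIn a => EIn :: enum_syms a | LOp o => [:: EOp o] end.

Definition gate_syms (g : gate) : seq esym :=
  enum_syms (g_name g) ++ [:: ESep] ++ label_syms (g_label g) ++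
  flatten (map (fun p => ESep :: enum_syms p) (g_preds g)) ++ [:: EGate].

Definition enc (C : circuit) (b : nat) : seq bool :=
  flatten (map esym_code
    (enum_syms (c_out C) ++ [:: ESep] ++ flatten (map gate_syms (c_gates C)) ++
     [:: ESep] ++ enum_syms b)).

Definition MC (O : op -> Prop) (w : seq bool) : Prop :=
  exists C b, valid_circuit O C /\ w = enc C b /\ I_C C b.

Inductive move := MoveL | MoveR | MoveS.

(* states 'I_(nq.+1) (start state 0); tape symbols 'I_(ng.+3), with
   0 = blank, 1 = bit false, 2 = bit true; the machine halts when
   delta is undefined and accepts iff it halts in an accepting state *)
Record TM := mkTM {
  tm_nq : nat; tm_ng : nat;
  tm_delta : 'I_tm_nq.+1 -> 'I_tm_ng.+3 ->
             option ('I_tm_nq.+1 * 'I_tm_ng.+3 * move);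
  tm_acc : 'I_tm_nq.+1 -> bool }.

Section TMsem.
Variable M : TM.
Notation Q := 'I_(tm_nq M).+1.
Notation G := 'I_(tm_ng M).+3.

Record config := Config { cf_st : Q; cf_left : seq G; cf_head : G; cf_right : seq G }.

Definition blank : G := ord0.
Definition bit_sym (b : bool) : G := if b then inord 2 else inord 1.

Definition init_config (w : seq bool) : config :=
  match map bit_sym w with
  | [::] => Config ord0 [::] blank [::]
  | s :: r => Config ord0 [::] s r
  end.

Definition step (c : config) : option config :=
  match tm_delta (cf_st c) (cf_head c) with
  | None => None
  | Some (q, s, m) =>
    Some match m with
    | MoveS => Config q (cf_left c) s (cf_right c)
    | MoveL => match cf_left c with
               | [::] => Config q [::] blank (s :: cf_right c)
               | x :: l => Config q l x (s :: cf_right c) end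
    | MoveR => match cf_right c with
               | [::] => Config q (s :: cf_left c) blank [::]
               | x :: r => Config q (s :: cf_left c) x r end
    end
  end.

Definition halted (c : config) : Prop := step c = None.

Fixpoint run (k : nat) (c : config) : config :=
  match k with
  | 0 => c
  | k'.+1 => match step c with None => c | Some c' => run k' c' end
  end.

Definition decides_in (L : seq bool -> Prop) (t : nat -> nat) : Prop :=
  forall w, exists k, k <= t (size w) /\ halted (run k (init_config w)) /\
    (tm_acc (cf_st (run k (init_config w))) <-> L w).
End TMsem.

Definition in_P (L : seq bool -> Prop) : Prop :=
  exists (M : TM) (c : nat), decides_in M L (fun n => c * n ^ c + c).

Definition in_E (L : seq bool -> Prop) : Prop :=
  exists (M : TM) (c : nat), decides_in M L (fun n => 2 ^ (c * n + c)).

Definition ops_cap_plus_div : op -> Prop :=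
  fun o => o = OCap \/ o = OPlus \/ o = ODiv.
Definition ops_cap_plus_times_div : op -> Prop :=
  fun o => o = OCap \/ o = OPlus \/ o = OTimes \/ o = ODiv.

(* Main.v *)
(* Without union and complement every gate computes at most one number, and
   this also holds for exact division.  Hence a circuit is evaluated gate by
   gate, by schoolbook arithmetic on binary numbers: reading the encoding from
   right to left meets predecessors before the gates that use them.  An
   addition lengthens numbers by at most one bit and a quotient is not longer
   than its dividend, so that without multiplication all numbers have at most
   as many bits as the input; a multiplication at most quadruples the length,
   so that with it they have at most 4^n bits.

   The evaluation is written as a program on finitely many stacks whose loops
   consume a stack, so that the running time is polynomial in a bound on the
   heights of the stacks.  A Turing machine holds each stack on a track of its
   tape and needs time linear in the heights for one push or pop. *)

(* Time is never counted along concrete runs. The precondition [wpre B] states the postcondition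
   together with the fact that no push exceeds height [B]; the number of executed instructions is
   then at most the syntactic expression [tb p B], a polynomial in [B] whose degree does not depend
   on the input. A fixed power of 2^O(n) is again 2^O(n), so (ii) yields E although the numbers may
   be exponentially long. A machine must also reject every word that is not an encoding. A
   functional parser therefore stands between language and stacks: it is shown to accept exactly the
   language by rebuilding a circuit from any accepted word, and the program is compared only with
   the parser. Every spelling of a number other than [bin n] has to be refused, so canonicity is
   tested on reading, whereas computed values may carry leading zeros and are compared by value. *)
From Stdlib Require Import FunctionalExtensionality.
From HB Require Import structures.
From mathcomp Require Import all_boot zify.
Require Import Defs.
Set Implicit Arguments. Unset Strict Implicit. Unset Printing Implicit Defensive.

(** * Turing machines over arbitrary finite types *)

Section FiniteTypeMachine.
Variables (Q G : finType) (q0 : Q) (g0 : G) (gbit : bool -> G).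
Variables (delta : Q -> G -> option (Q * G * move)) (acc : Q -> bool).

Record fconfig := FConfig { fst_ : Q; fleft : seq G; fhead : G; fright : seq G }.

Definition fmove (m : move) (q : Q) (l : seq G) (s : G) (r : seq G) : fconfig :=
  match m with
  | MoveS => FConfig q l s r
  | MoveL => FConfig q (behead l) (head g0 l) (s :: r)
  | MoveR => FConfig q (s :: l) (head g0 r) (behead r)
  end.

Definition fstep (c : fconfig) : option fconfig :=
  match delta (fst_ c) (fhead c) with
  | None => None
  | Some (q, s, m) => Some (fmove m q (fleft c) s (fright c))
  end.

Fixpoint frun (k : nat) (c : fconfig) : fconfig :=
  match k with
  | 0 => c
  | k'.+1 => match fstep c with None => c | Some c' => frun k' c' end
  end.

Definition finit (w : seq bool) : fconfig :=
  FConfig q0 [::] (head g0 (map gbit w)) (behead (map gbit w)).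

Lemma frunD a b c : frun (a + b) c = frun b (frun a c).
Proof.
elim: a c => [|a IH] c //=; case E: (fstep c) => [c'|] //=.
by case: b {IH} => //= b; rewrite E.
Qed.

(** State 0 and symbols 0, 1, 2 have prescribed roles in a [TM], so they are added as second names
    of [q0], [g0] and the two bits. Decoding is thus not injective, and the simulation is stated
    along decoding. *)
Definition decQ (o : 'I_#|Q|.+1) : Q :=
  if unlift ord0 o is Some j then enum_val j else q0.
Definition encQ (q : Q) : 'I_#|Q|.+1 := lift ord0 (enum_rank q).

Lemma encQK : cancel encQ decQ.
Proof. by move=> q; rewrite /decQ /encQ liftK enum_rankK. Qed.

Definition decG (o : 'I_#|G|.+3) : G :=
  match nat_of_ord o with
  | 0 => g0 | 1 => gbit false | 2 => gbit true | k.+3 => nth g0 (enum G) k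
  end.
Definition encG (g : G) : 'I_#|G|.+3 := inord (index g (enum G)).+3.

Lemma encGK : cancel encG decG.
Proof.
move=> g; rewrite /decG /encG inordK ?nth_index ?mem_enum //.
by rewrite !ltnS cardE index_mem mem_enum.
Qed.

Definition machine : TM :=
  @mkTM #|Q| #|G|
    (fun q s => match delta (decQ q) (decG s) with
                | None => None
                | Some (q', s', m) => Some (encQ q', encG s', m)
                end)
    (fun q => acc (decQ q)).

Definition dec_config (c : config machine) : fconfig :=
  FConfig (decQ (cf_st c)) (map decG (cf_left c)) (decG (cf_head c))
          (map decG (cf_right c)).

Lemma dec_step c : omap dec_config (step c) = fstep (dec_config c).
Proof.
case: c => q l s r; rewrite /step /fstep /=.
case: (delta (decQ q) (decG s)) => [[[q' s'] m]|] //=; congr Some.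
rewrite /dec_config /fmove.
by case: m => /=; [case: l => [|x l] | case: r => [|x r] |];
  rewrite /= ?encQK ?encGK.
Qed.

Lemma dec_run k c : dec_config (run k c) = frun k (dec_config c).
Proof.
elim: k c => [|k IH] c //=; rewrite -dec_step.
by case: (step c) => [c'|] //=; rewrite IH.
Qed.

Lemma dec_init w : dec_config (init_config machine w) = finit w.
Proof.
have decb b : decG (@bit_sym machine b) = gbit b.
  by rewrite /bit_sym /decG; case: b; rewrite inordK.
have dec0 : decQ ord0 = q0 by rewrite /decQ unlift_none.
rewrite /init_config /finit /dec_config; case: w => [|b w] /=; rewrite dec0 //.
rewrite decb -map_comp; congr FConfig.
by apply: eq_map => x /=; rewrite decb.
Qed.

Lemma machine_decides (L : seq bool -> Prop) (t : nat -> nat) :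
  (forall w, exists2 k, k <= t (size w) &
     fstep (frun k (finit w)) = None /\ (acc (fst_ (frun k (finit w))) <-> L w)) ->
  decides_in machine L t.
Proof.
move=> H w; have [k kt [hk ak]] := H w; exists k; split=> //.
move: (dec_run k (init_config machine w)); rewrite dec_init => E.
move: hk ak; rewrite -E -dec_step /halted /= => hk ak; split=> //.
by case: (step _) hk.
Qed.

End FiniteTypeMachine.

(** * Stack programs *)

Section StackPrograms.
Variables (reg sym : finType).

Notation state := (reg -> seq sym).

Definition upd (s : state) (r : reg) (v : seq sym) : state :=
  fun r' => if r' == r then v else s r'.

Lemma upd_id s r : upd s r (s r) = s.
Proof. by apply: functional_extensionality => r'; rewrite /upd; case: eqP => [->|]. Qed.

Inductive prog :=
  | Skip
  | Push of reg & sym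
  | Case of reg & (option sym -> prog)
  | Loop of reg & (sym -> prog)
  | Seq of prog & prog.

(* [Case] pops the register and branches on the popped symbol ([None] when the
   register is empty); [Loop] pops until the register is empty, and its body
   may not change the remaining content.  [B] bounds all register lengths. *)
Fixpoint wpre (B : nat) (p : prog) (Q : state -> Prop) (s : state) : Prop :=
  match p with
  | Skip => Q s
  | Push r x => size (s r) < B /\ Q (upd s r (x :: s r))
  | Case r f => wpre B (f (ohead (s r))) Q (upd s r (behead (s r)))
  | Loop r f =>
    (fix go (l : seq sym) (s : state) : Prop :=
       match l with
       | [::] => Q s
       | x :: l' => wpre B (f x) (fun s' => s' r = l' /\ go l' s') (upd s r l')
       end) (s r) s
  | Seq p q => wpre B p (wpre B q Q) s
  end.

Lemma wp_mono B p (Q Q' : state -> Prop) s :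
  (forall s, Q s -> Q' s) -> wpre B p Q s -> wpre B p Q' s.
Proof.
elim: p Q Q' s => [|r x|r f IH|r f IH|p IHp q IHq] Q Q' s QQ' //=.
- exact: QQ'.
- by case=> ? /QQ'.
- exact: IH.
- move: (s r) => l; elim: l s => [|x l IHl] s; first exact: QQ'.
  by apply: IH => s' [E H]; split=> //; apply: IHl.
- by apply: IHp => s'; apply: IHq.
Qed.

Lemma wp_loop B (I : seq sym -> state -> Prop) r f (Q : state -> Prop) s :
  I (s r) s ->
  (forall s, s r = [::] -> I [::] s -> Q s) ->
  (forall x l s, s r = x :: l -> I (x :: l) s ->
     wpre B (f x) (fun s' => s' r = l /\ I l s') (upd s r l)) ->
  wpre B (Loop r f) Q s.
Proof.
move=> I0 IQ IS /=.
suff H l s' : s' r = l -> I l s' ->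
    (fix go (l : seq sym) (s : state) : Prop :=
       match l with
       | [::] => Q s
       | x :: l' => wpre B (f x) (fun s' => s' r = l' /\ go l' s') (upd s r l')
       end) l s' by exact: H.
elim: l s' => [|x l IHl] s' Es Is; first exact: IQ.
by apply: wp_mono (IS _ _ _ Es Is) => s'' [E' I']; split=> //; apply: IHl.
Qed.

Lemma wp_skipE B Q s : wpre B Skip Q s = Q s.
Proof. by []. Qed.
Lemma wp_pushE B r x Q s :
  wpre B (Push r x) Q s = (size (s r) < B /\ Q (upd s r (x :: s r))).
Proof. by []. Qed.
Lemma wp_caseE B r f Q s :
  wpre B (Case r f) Q s = wpre B (f (ohead (s r))) Q (upd s r (behead (s r))).
Proof. by []. Qed.
Lemma wp_seqE B p q Q s : wpre B (Seq p q) Q s = wpre B p (wpre B q Q) s.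
Proof. by []. Qed.

(** Counts pushes and pops, each worth at most [2 * B + 5] machine steps. Branches are summed
    instead of maximised. A loop has at most [B] rounds since each consumes a symbol; the final 1 is
    the pop that finds the register empty. *)
Fixpoint tb (p : prog) (B : nat) : nat :=
  match p with
  | Skip => 0
  | Push _ _ => 1
  | Case _ f => 1 + \sum_(o : option sym) tb (f o) B
  | Loop _ f => B * (1 + \sum_(x : sym) tb (f x) B) + 1
  | Seq p q => tb p B + tb q B
  end.

Lemma sum_poly (I : finType) (F : I -> nat -> nat) :
  (forall i, exists K D, forall B, F i B <= K * B.+1 ^ D) ->
  exists K D, forall B, \sum_i F i B <= K * B.+1 ^ D.
Proof.
move=> H; suff [K [D HKD]] : exists K D, forall B,
    \sum_(i <- enum I) F i B <= K * B.+1 ^ D.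
  by exists K, D => B; move: (HKD B); rewrite big_enum.
elim: (enum I) => [|i l [K [D IH]]]; first by exists 0, 0 => B; rewrite big_nil.
have [K' [D' H']] := H i; exists (K + K'), (maxn D D') => B.
rewrite big_cons addnC mulnDl; apply: leq_add.
  by apply: leq_trans (IH B) _; rewrite leq_mul2l leq_pexp2l ?leq_maxl ?orbT.
by apply: leq_trans (H' B) _; rewrite leq_mul2l leq_pexp2l ?leq_maxr ?orbT.
Qed.

(** The exponent rises only at a loop, by one per level of nesting; choosing among finitely many
    branches affects the constant alone. *)
Lemma tb_poly p : exists K D, forall B, tb p B <= K * B.+1 ^ D.
Proof.
elim: p => [|r x|r f IH|r f IH|p [K [D HK]] q [K' [D' HK']]].
- by exists 0, 0.
- by exists 1, 0.
- have [K [D HK]] := sum_poly IH; exists K.+1, D => B /=.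
  by rewrite mulSn leq_add ?expn_gt0.
- have [K [D HK]] := sum_poly IH; exists K.+2, D.+1 => B /=.
  have P0 : 0 < B.+1 ^ D by rewrite expn_gt0.
  have := HK B; rewrite expnS; move: (B.+1 ^ D) P0 (\sum_i _) => P P0 S HS.
  by nia.
- exists (K + K'), (maxn D D') => B /=; rewrite mulnDl; apply: leq_add.
    by apply: leq_trans (HK B) _; rewrite leq_mul2l leq_pexp2l ?leq_maxl ?orbT.
  by apply: leq_trans (HK' B) _; rewrite leq_mul2l leq_pexp2l ?leq_maxr ?orbT.
Qed.

Inductive instr (X : Type) :=
  | IPush of reg & sym & X
  | IPop of reg & (option sym -> X)
  | IHalt of bool.

(** Control points, one per instruction. In [Case] and [Loop] the point [None] is the pop itself and
    the others lie in the branches; finiteness comes from the finiteness of [sym]. *)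
Fixpoint pcT (p : prog) : finType :=
  match p with
  | Skip => void
  | Push _ _ => unit
  | Case _ f => option {o : option sym & pcT (f o)}
  | Loop _ f => option {x : sym & pcT (f x)}
  | Seq p q => (pcT p + pcT q)%type
  end.

(** Compilation in continuation style: [emb] places the control points of the subprogram inside the
    whole program and [ex] is where control goes afterwards. [Skip] has no point of its own, so its
    entry is already its exit. *)
Fixpoint entry (p : prog) (X : Type) : (pcT p -> X) -> X -> X :=
  match p return (pcT p -> X) -> X -> X with
  | Skip => fun _ ex => ex
  | Push _ _ => fun emb _ => emb tt
  | Case _ _ => fun emb _ => emb None
  | Loop _ _ => fun emb _ => emb None
  | Seq p q => fun emb ex => entry (emb \o inl) (entry (emb \o inr) ex)
  end.

Fixpoint code (p : prog) (X : Type) : (pcT p -> X) -> X -> pcT p -> instr X :=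
  match p return (pcT p -> X) -> X -> pcT p -> instr X with
  | Skip => fun _ _ _ => IHalt X false
  | Push r x => fun _ ex _ => IPush r x ex
  | Case r f => fun emb ex c =>
    match c with
    | None => IPop r (fun o =>
        entry (fun c => emb (Some (existT (fun o => pcT (f o)) o c))) ex)
    | Some (existT o c) =>
        code (fun c => emb (Some (existT (fun o => pcT (f o)) o c))) ex c
    end
  | Loop r f => fun emb ex c =>
    match c with
    | None => IPop r (fun o =>
        match o with
        | None => ex
        | Some x =>
          entry (fun c => emb (Some (existT (fun x => pcT (f x)) x c))) (emb None)
        end)
    | Some (existT x c) =>
        code (fun c => emb (Some (existT (fun x => pcT (f x)) x c))) (emb None) c
    end
  | Seq p q => fun emb ex c =>
    match c with
    | inl c => code (emb \o inl) (entry (emb \o inr) ex) c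
    | inr c => code (emb \o inr) ex c
    end
  end.

(** * Simulation of stack programs by a Turing machine *)

(* Register [r] is stored on track [r] of the cells to the right of a marker,
   bottom of the stack next to the marker. Raw input bits are read as cells
   whose only nonempty track is that of the input register. *)
Variables (inreg : reg) (dg : bool -> sym).

Definition cell : finType := option (option (bool + {ffun reg -> option sym})).
Definition cblank : cell := None.
Definition cmark : cell := Some None.
Definition cbit (b : bool) : cell := Some (Some (inl b)).

Definition track (c : cell) (r : reg) : option sym :=
  match c with
  | Some (Some (inl b)) => if r == inreg then Some (dg b) else None
  | Some (Some (inr f)) => f r
  | _ => None
  end.
Definition set_track (c : cell) (r : reg) (o : option sym) : cell :=
  Some (Some (inr [ffun r' => if r' == r then o else track c r'])).

Lemma track_set c r o r' :
  track (set_track c r o) r' = if r' == r then o else track c r'.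
Proof. by rewrite /= ffunE. Qed.

Variables (X : finType) (M : X -> instr X) (x0 : X).

Definition ctl : finType := option (X + (X + X)).
Definition qstart : ctl := None.
Definition qready (x : X) : ctl := Some (inl x).
Definition qseek (x : X) : ctl := Some (inr (inl x)).
Definition qlook (x : X) : ctl := Some (inr (inr x)).

(** Every instruction starts and ends on the marker. The head seeks the first cell whose track [r]
    is empty; a push writes there, while a pop steps back once and looks at the top, or at the
    marker if the stack is empty. The start state puts the marker left of the input. *)
Definition sdelta (q : ctl) (c : cell) : option (ctl * cell * move) :=
  match q with
  | None => if c == cmark then Some (qready x0, cmark, MoveS)
            else if c == cblank then Some (qready x0, cmark, MoveS)
            else Some (qstart, c, MoveL)
  | Some (inl x) =>
    if c == cmark then
      if M x is IHalt _ then None else Some (qseek x, c, MoveR)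
    else Some (qready x, c, MoveL)
  | Some (inr (inl x)) =>
    match M x with
    | IPush r a y => if track c r is Some _ then Some (qseek x, c, MoveR)
                     else Some (qready y, set_track c r (Some a), MoveL)
    | IPop r f => if track c r is Some _ then Some (qseek x, c, MoveR)
                  else Some (qlook x, c, MoveL)
    | IHalt _ => None
    end
  | Some (inr (inr x)) =>
    match M x with
    | IPop r f => if c == cmark then Some (qready (f None), c, MoveS)
                  else Some (qready (f (track c r)), set_track c r None, MoveL)
    | _ => None
    end
  end.

Definition sacc (q : ctl) : bool :=
  if q is Some (inl x) then (if M x is IHalt b then b else false) else false.

Notation run' := (frun cblank sdelta).

Definition conf_at (t : seq cell) (j : nat) (q : ctl) : fconfig ctl cell :=
  FConfig q (rev (take j t)) (nth cblank t j) (drop j.+1 t).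

(** The last clause ensures that the leftward run after an instruction stops at cell 0 only. *)
Definition tape_ok (t : seq cell) (s : state) : Prop :=
  [/\ nth cblank t 0 = cmark,
      forall r j, track (nth cblank t j.+1) r = onth (rev (s r)) j &
      forall j, nth cblank t j.+1 != cmark].

Lemma move_right t j q c : j <= size t ->
  fmove cblank MoveR q (rev (take j t)) c (drop j.+1 t)
  = conf_at (set_nth cblank t j c) j.+1 q.
Proof.
move=> Hj; rewrite /conf_at /fmove; congr FConfig.
- elim: t j Hj => [|a t IH] [|j] //= Hj; first by rewrite take0.
  by rewrite !rev_cons -IH // rcons_cons.
- rewrite nth_set_nth /= gtn_eqF // -nth0 nth_drop addn0 //.
- rewrite -drop1 drop_drop add1n.
  by elim: t j Hj => [|a t IH] [|j] //= Hj; apply: IH.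
Qed.

Lemma move_left t j q c : j < size t ->
  fmove cblank MoveL q (rev (take j.+1 t)) c (drop j.+2 t)
  = conf_at (set_nth cblank t j.+1 c) j q.
Proof.
move=> Hj; rewrite /conf_at /fmove (take_nth cblank) // rev_rcons /=.
rewrite nth_set_nth /= ltn_eqF //; congr FConfig.
  by congr rev; elim: t j Hj => [|a t IH] [|j] //= Hj; rewrite -IH.
elim: t j Hj => [|a t IH] [|j] // Hj; last exact: IH.
by case: t {IH Hj} => [|b t] //=; rewrite !drop0.
Qed.

(** Quantified over all tapes for [s], because raw input bits, erased cells and trailing blanks give
    one state many tapes. *)
Definition goes (k : nat) (x : X) (s : state) (x' : X) (s' : state) : Prop :=
  forall t, tape_ok t s -> exists k' t',
    [/\ k' <= k, run' k' (conf_at t 0 (qready x)) = conf_at t' 0 (qready x')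
      & tape_ok t' s'].

Lemma goes_refl x s : goes 0 x s x s.
Proof. by move=> t Ht; exists 0, t. Qed.

Lemma goes_trans k1 k2 k x1 s1 x2 s2 x3 s3 : k1 + k2 <= k ->
  goes k1 x1 s1 x2 s2 -> goes k2 x2 s2 x3 s3 -> goes k x1 s1 x3 s3.
Proof.
move=> Hk H1 H2 t Ht.
have [a [ta [Ha Ea Ta]]] := H1 t Ht; have [b [tb [Hb Eb Tb]]] := H2 ta Ta.
exists (a + b), tb; split=> //; last by rewrite frunD Ea.
by apply: leq_trans Hk; apply: leq_add.
Qed.

Lemma set_nth_id t j : j < size t -> set_nth cblank t j (nth cblank t j) = t.
Proof. by elim: t j => [|a t IH] [|j] //= Hj; rewrite IH. Qed.

Lemma tape_size t s r j : tape_ok t s -> j <= size (s r) -> j < size t.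
Proof.
case=> H0 H1 H2; case: j => [|j] Hj.
  by case: t H0 {H1 H2}.
rewrite ltnNge; apply/negP => Hs.
by have := onthTE (rev (s r)) j; rewrite size_rev Hj -H1 nth_default.
Qed.

Lemma run_back t j y s : tape_ok t s -> j < size t ->
  run' j (conf_at t j (qready y)) = conf_at t 0 (qready y).
Proof.
move=> Ht; elim: j => [|j IH] Hj //=.
case: (Ht) => _ _ Hm; rewrite /fstep /= (negbTE (Hm j)) move_left ?(ltnW Hj) //.
by rewrite set_nth_id // IH // ltnW.
Qed.

Lemma run_seek t s x r j : tape_ok t s ->
  sdelta (qready x) cmark = Some (qseek x, cmark, MoveR) ->
  (forall c, track c r -> sdelta (qseek x) c = Some (qseek x, c, MoveR)) ->
  j <= size (s r) ->
  run' j.+1 (conf_at t 0 (qready x)) = conf_at t j.+1 (qseek x).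
Proof.
move=> Ht Hm Hx; elim: j => [|j IH] Hj.
  have St := tape_size Ht Hj.
  case: (Ht) => H0 _ _; rewrite /frun /fstep [fhead _]H0 Hm -[in LHS]H0.
  by rewrite move_right ?set_nth_id.
rewrite -addn1 frunD IH ?(ltnW Hj) // /frun /fstep.
have St := tape_size Ht Hj.
case: (Ht) => _ H1 _; rewrite Hx; last first.
  by rewrite [fhead _]/(nth _ _ _) H1 onthTE size_rev.
by rewrite move_right ?(ltnW St) // set_nth_id // addn1.
Qed.

Lemma goes_push B x s r a y : M x = IPush r a y -> size (s r) < B ->
  goes (2 * B + 5) x s y (upd s r (a :: s r)).
Proof.
move=> Mx Hs t Ht; have St := tape_size Ht (leqnn (size (s r))).
set j := size (s r) in Hs St *.
have Hseek : run' j.+1 (conf_at t 0 (qready x)) = conf_at t j.+1 (qseek x).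
  apply: (run_seek Ht) (leqnn _) => /=; rewrite ?Mx //.
  by move=> c; case: (track c r).
case: (Ht) => H0 H1 H2; set c := set_track (nth cblank t j.+1) r (Some a).
have Ht' : tape_ok (set_nth cblank t j.+1 c) (upd s r (a :: s r)).
  split; first by rewrite nth_set_nth.
    move=> r' i; rewrite nth_set_nth /= eqSS /upd; case: eqP => [->|ij].
      rewrite track_set; case: eqP => [_|_]; last exact: H1.
      by rewrite rev_cons -cats1 onth_cat size_rev ltnn subnn.
    rewrite H1; case: eqP => [->|] //; rewrite rev_cons -cats1 onth_cat size_rev.
    case: ltngtP => // ji; rewrite onth_default ?size_rev ?(ltnW ji) //.
    by rewrite onth_default //= subn_gt0.
  by move=> i; rewrite nth_set_nth /= eqSS; case: (i == _).
exists (j.+1 + (1 + j)), (set_nth cblank t j.+1 c); split=> //; first by lia.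
rewrite !frunD Hseek /= /fstep /= Mx H1 onth_default ?size_rev //.
rewrite move_left // -/c (run_back _ Ht') // size_set_nth.
by rewrite leq_max St orbT.
Qed.

Lemma goes_pop B x s r f : M x = IPop r f -> size (s r) <= B ->
  goes (2 * B + 5) x s (f (ohead (s r))) (upd s r (behead (s r))).
Proof.
move=> Mx Hs t Ht; have St := tape_size Ht (leqnn (size (s r))).
have Hseek : run' (size (s r)).+1 (conf_at t 0 (qready x))
    = conf_at t (size (s r)).+1 (qseek x).
  apply: (run_seek Ht) (leqnn _) => /=; rewrite ?Mx //.
  by move=> c; case: (track c r).
case: (Ht) => H0 H1 H2.
(* The cell above the top is written back unchanged; this may lengthen the list by a blank but
   leaves the tape the same. *)
set t2 := set_nth cblank t (size (s r)).+1 (nth cblank t (size (s r)).+1).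
have nt2 i : nth cblank t2 i = nth cblank t i.
  by rewrite nth_set_nth /=; case: eqP => [->|].
have Ht2 : tape_ok t2 s by split=> *; rewrite nt2.
have St2 := tape_size Ht2 (leqnn (size (s r))).
have Hlook : run' (size (s r)).+2 (conf_at t 0 (qready x))
    = conf_at t2 (size (s r)) (qlook x).
  rewrite -addn1 frunD Hseek /= /fstep /= Mx H1 onth_default ?size_rev //.
  by rewrite move_left.
case Es: (s r) => [|a l] in Hs Hlook St2 *.
  exists 3, t2; split; first by lia.
    rewrite -[3]addn1 frunD Hlook /= /fstep /= Mx nt2 H0 eqxx.
    by rewrite /conf_at nt2 H0.
  by rewrite /= -{1}Es upd_id.
have Ea : track (nth cblank t2 (size l).+1) r = Some a.
  by rewrite nt2 H1 Es rev_cons -cats1 onth_cat size_rev ltnn subnn.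
set c := set_track (nth cblank t2 (size l).+1) r None.
set t3 := set_nth cblank t2 (size l).+1 c.
have Ht3 : tape_ok t3 (upd s r l).
  case: (Ht2) => A0 A1 A2; split; first by rewrite nth_set_nth.
    move=> r' i; rewrite nth_set_nth /= eqSS /upd; case: eqP => [->|il].
      rewrite track_set; case: eqP => [_|_]; last exact: A1.
      by rewrite onth_default ?size_rev.
    rewrite A1; case: eqP => [->|] //; rewrite Es rev_cons -cats1 onth_cat size_rev.
    case: ltngtP => // li; rewrite onth_default; last by rewrite subn_gt0.
    by rewrite onth_default ?size_rev // ltnW.
  by move=> i; rewrite nth_set_nth /= eqSS; case: (i == _).
exists ((size (a :: l)).+2 + (1 + size l)), t3; split=> //; first by move: Hs => /= Hs; lia.
rewrite !frunD Hlook; case: (Ht2) => A0 A1 A2.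
rewrite /= /fstep /= Mx (negbTE (A2 _)) Ea.
rewrite move_left ?(ltnW St2) //.
by rewrite (run_back _ Ht3) // size_set_nth leq_max ltnS ltnW ?orbT.
Qed.

Definition bnd (B : nat) (s : state) := forall r, size (s r) <= B.

Lemma bnd_upd B s r v : bnd B s -> size v <= B -> bnd B (upd s r v).
Proof. by move=> Hs Hv r'; rewrite /upd; case: eqP. Qed.

(** Correctness of the compilation together with its running time. The induction keeps [emb] and
    [ex] arbitrary, since a subprogram may sit anywhere and a loop body exits to the head of its
    loop. *)
Lemma goes_prog B p (emb : pcT p -> X) (ex : X) (Q : state -> Prop) s :
  (forall c, M (emb c) = code emb ex c) -> bnd B s -> wpre B p Q s ->
  exists s', [/\ goes (tb p B * (2 * B + 5)) (entry emb ex) s ex s', bnd B s' & Q s'].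
Proof.
elim: p emb ex Q s => [|r x|r f IH|r f IH|p IHp q IHq] emb ex Q s HM Bs.
- by move=> HQ; exists s; split=> //; apply: goes_refl.
- move=> [Hs HQ]; exists (upd s r (x :: s r)); split=> //.
    by rewrite mul1n; apply: goes_push Hs; apply: HM.
  exact: bnd_upd.
- move=> Hw; have Bs' : bnd B (upd s r (behead (s r))).
    by apply: bnd_upd => //; rewrite size_behead; apply: leq_trans (leq_pred _) _.
  have [|s' [Hg B' Q']] := IH (ohead (s r))
     (fun c => emb (Some (existT (fun o => pcT (f o)) _ c))) ex Q _ _ Bs' Hw.
    by move=> c; rewrite HM.
  exists s'; split=> //=.
  apply: goes_trans (goes_pop (HM None) (Bs r)) Hg.
  rewrite -mulSn leq_mul2r; apply/orP; right.
  by rewrite add1n ltnS (bigD1 (ohead (s r))) //= leq_addr.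
(* Inner induction on the content of the loop register: [T] pays for popping one symbol and running
   its body, and the last pop costs one more. *)
- move=> /= Hw; set T := 1 + _.
  suff H l : size l <= B -> forall s, s r = l -> bnd B s ->
     (fix go (l : seq sym) (s : state) : Prop :=
       match l with
       | [::] => Q s
       | x :: l' => wpre B (f x) (fun s' => s' r = l' /\ go l' s') (upd s r l')
       end) l s -> exists s',
     [/\ goes ((size l * T + 1) * (2 * B + 5)) (emb None) s ex s', bnd B s' & Q s'].
    have [|s' [H1 H2 H3]] := H (s r) _ s erefl Bs Hw; first exact: Bs.
    exists s'; split=> // t Ht; have [k' [t' [Hk E1 E2]]] := H1 t Ht.
    exists k', t'; split=> //; apply: leq_trans Hk _.
    by rewrite leq_mul2r leq_add2r leq_mul2r Bs !orbT.
  elim: l => [|x l IHl] Hl {Hw Bs}s Es Bs Hw.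
    exists s; split=> //.
    have := goes_pop (HM None) (Bs r); rewrite Es /= -Es upd_id.
    by rewrite mul0n mul1n.
  have Bs' : bnd B (upd s r l) by apply: bnd_upd => //; apply: ltnW.
  have [|s1 [Hg B1 [E1 Q1]]] := IH x
     (fun c => emb (Some (existT (fun o => pcT (f o)) _ c))) (emb None) _ _ _ Bs' Hw.
    by move=> c; rewrite HM.
  have [s2 [Hg2 B2 Q2]] := IHl (ltnW Hl) s1 E1 B1 Q1.
  exists s2; split=> //.
  have := goes_pop (HM None) (Bs r); rewrite Es /= => Hg0.
  apply: goes_trans _ Hg0 (goes_trans (leqnn _) Hg Hg2).
  rewrite -mulnDl -mulSn leq_mul2r; apply/orP; right.
  rewrite /T mulSn -add1n !addnA leq_add2r leq_add2r leq_add2l.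
  by rewrite (bigD1 x) //= leq_addr.
- move=> /= Hw.
  have [|s1 [Hg B1 Q1]] := IHp (emb \o inl) (entry (emb \o inr) ex) _ _ _ Bs Hw.
    by move=> c; rewrite /= HM.
  have [|s2 [Hg2 B2 Q2]] := IHq (emb \o inr) ex _ _ _ B1 Q1.
    by move=> c; rewrite /= HM.
  exists s2; split=> //; apply: goes_trans Hg Hg2.
  by rewrite mulnDl.
Qed.

Definition input_state (w : seq bool) : state :=
  fun r => if r == inreg then rev (map dg w) else [::].

Lemma tape_ok_input w : tape_ok (cmark :: map cbit w) (input_state w).
Proof.
have nthw j : nth cblank (map cbit w) j = if onth w j is Some b then cbit b else cblank.
  by elim: w j => [|b w IH] [|j] //=.
split=> // [r j|j] /=; rewrite nthw /input_state; last by case: (onth w j).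
case: eqP => [->|/eqP/negbTE rE]; last by rewrite onth0n; case: (onth w j) => [b|] //=; rewrite rE.
by rewrite revK onth_map; case: (onth w j) => [b|] //=; rewrite eqxx.
Qed.

Lemma run_start w : exists2 k, k <= 2 &
  run' k (finit qstart cblank cbit w) = conf_at (cmark :: map cbit w) 0 (qready x0).
Proof.
case: w => [|b w]; first by exists 1.
by exists 2 => //=; rewrite /conf_at /= drop0.
Qed.

End StackPrograms.

(** * Deciding a language by a stack program *)

Section Decision.
Variables (reg sym : finType) (inreg outreg : reg) (dg : bool -> sym).
Variable p : prog reg sym.

Definition dctl : finType := (pcT p + (unit + bool))%type.
Definition dexit : dctl := inr (inl tt).
Definition dcode (x : dctl) : instr reg sym dctl :=
  match x with
  | inl c => code inl dexit c
  | inr (inl _) => IPop outreg (fun o => inr (inr (isSome o)))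
  | inr (inr b) => IHalt _ _ _ b
  end.

Lemma prog_decides (L : seq bool -> Prop) (Bf : nat -> nat) :
  (forall w, size w <= Bf (size w) /\
     wpre (Bf (size w)) p (fun s => s outreg <> [::] <-> L w) (input_state inreg dg w)) ->
  exists (M : TM) K D, decides_in M L (fun n => K * (Bf n).+1 ^ D).
Proof.
move=> H; have [K [D HKD]] := tb_poly p.
set x0 := entry inl dexit.
(* The time is at most 2 for the start plus [2 * B + 5] for each instruction and for the final pop
   of [outreg]. As [2 * B + 5 <= 5 * B.+1], the factor 7 absorbs everything and the exponent grows
   by one. *)
exists (machine (qstart dctl) (cblank reg sym) (@cbit reg sym)
          (sdelta inreg dg dcode x0) (sacc dcode)), (7 * K + 7), D.+1.
apply: machine_decides => w; have [wB Hw] := H w.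
set B := Bf (size w) in wB Hw *.
have Bi : bnd B (input_state inreg dg w).
  by move=> r; rewrite /input_state; case: eqP; rewrite // size_rev size_map.
have [|s' [Hg Bs Hs']] := goes_prog inreg dg (M := dcode) x0 (emb := inl) (ex := dexit) _ Bi Hw.
  by [].
have Bo := Bs outreg.
have Hh : goes inreg dg dcode x0 (2 * B + 5) dexit s' (inr (inr (isSome (ohead (s' outreg)))))
    (upd s' outreg (behead (s' outreg))).
  by apply: (@goes_pop _ _ _ _ _ dcode x0 B dexit s' outreg
      (fun o => inr (inr (isSome o)))).
have [k1 Hk1 E1] := run_start inreg dg dcode x0 w.
have [k2 [t [Hk2 E2 Ht]]] := goes_trans (leqnn _) Hg Hh (tape_ok_input inreg dg w).
exists (k1 + k2).
  apply: leq_trans (leq_add Hk1 Hk2) _; rewrite expnS.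
  have P0 : 0 < B.+1 ^ D by rewrite expn_gt0.
  by move: (HKD B) P0; move: (tb p B) (B.+1 ^ D) => T P HT P0; nia.
rewrite frunD E1 E2; case: Ht => Ht0 _ _; split.
  by rewrite /fstep [fhead _]Ht0.
by rewrite /= -Hs'; case: (s' outreg) => //=; split=> //.
Qed.

End Decision.

Opaque wpre.

(** * Binary arithmetic on bit lists, least significant bit first *)

Notation bits := (seq bool).

Fixpoint nv (l : bits) : nat := if l is b :: l' then b + (nv l').*2 else 0.

Lemma nv_cat u v : nv (u ++ v) = nv u + 2 ^ size u * nv v.
Proof. by elim: u => [|b u IH] /=; rewrite ?mul1n // IH expnS; lia. Qed.

Lemma nv_lt u : nv u < 2 ^ size u.
Proof. by elim: u => [|b u IH] //=; rewrite expnS; case: b; lia. Qed.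

Lemma nv_eq0 u : (nv u == 0) = ~~ has id u.
Proof. by elim: u => [|[] u IH] //=; rewrite -IH; lia. Qed.

(* [d] selects subtraction; [c] is the carry, respectively the borrow. *)
Definition abit (x y c : bool) : bool := x (+) y (+) c.
(** The majority of three bits is the carry; complementing the minuend bit turns it into the borrow,
    while the result bit [abit] is common to both operations. *)
Definition acar (d x y c : bool) : bool :=
  let x := x (+) d in (x && y) || (x && c) || (y && c).

Fixpoint ar0 (d c : bool) (y : bits) : bits * bool :=
  if y is b :: y' then
    let r := ar0 d (acar d false b c) y' in (abit false b c :: r.1, r.2)
  else ([::], c).
Fixpoint ar (d c : bool) (x y : bits) : bits * bool :=
  if x is a :: x' then
    let b := head false y in
    let r := ar d (acar d a b c) x' (behead y) in (abit a b c :: r.1, r.2)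
  else ar0 d c y.

Lemma size_ar0 d c y : size (ar0 d c y).1 = size y.
Proof. by elim: y c => [|b y IH] c //=; rewrite IH. Qed.

Lemma size_ar d c x y : size (ar d c x y).1 = maxn (size x) (size y).
Proof.
elim: x c y => [|a x IH] c y /=; first by rewrite size_ar0 max0n.
by rewrite IH size_behead; lia.
Qed.

Lemma ar0_add c y : nv (ar0 false c y).1 + 2 ^ size y * (ar0 false c y).2 = nv y + c.
Proof.
elim: y c => [|b y IH] c /=; first by rewrite mul1n.
have := IH (acar false false b c); rewrite expnS.
by case: b c => [] [] /=; move: (ar0 _ _ _).2 (nv _) (nv y) (2 ^ _) => [] u v w; lia.
Qed.

Lemma ar0_sub c y :
  2 ^ size y * (ar0 true c y).2 = nv (ar0 true c y).1 + nv y + c.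
Proof.
elim: y c => [|b y IH] c /=; first by rewrite mul1n.
have := IH (acar true false b c); rewrite expnS.
by case: b c => [] [] /=; move: (ar0 _ _ _).2 (nv _) (nv y) (2 ^ _) => [] u v w; lia.
Qed.

Lemma nv_head y : nv y = head false y + (nv (behead y)).*2.
Proof. by case: y. Qed.

Lemma ar_add c x y :
  nv (ar false c x y).1 + 2 ^ size (ar false c x y).1 * (ar false c x y).2
  = nv x + nv y + c.
Proof.
elim: x c y => [|a x IH] c y /=; first by rewrite size_ar0 ar0_add.
have := IH (acar false a (head false y) c) (behead y).
rewrite (nv_head y) expnS.
move: (ar _ _ _ _).2 (nv (ar _ _ _ _).1) (nv (behead _)) (2 ^ _) => e u v w.
by case: a (head false y) c e => [] [] [] [] /=; lia.
Qed.

(** Written additively, so that it also covers a negative difference, which truncated subtraction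
    would lose: the outgoing borrow then counts one power of two. *)
Lemma ar_sub c x y :
  nv x + 2 ^ size (ar true c x y).1 * (ar true c x y).2
  = nv (ar true c x y).1 + nv y + c.
Proof.
elim: x c y => [|a x IH] c y /=; first by rewrite size_ar0 ar0_sub.
have := IH (acar true a (head false y) c) (behead y).
rewrite (nv_head y) expnS.
move: (ar _ _ _ _).2 (nv (ar _ _ _ _).1) (nv (behead _)) (2 ^ _) => e u v w.
by case: a (head false y) c e => [] [] [] [] /=; lia.
Qed.

Definition badd (x y : bits) : bits := let r := ar false false x y in rcons r.1 r.2.
Definition blt (x y : bits) : bool := (ar true false x y).2.
(** Lists with leading zeros have equal values without being equal, hence the test goes through the
    subtraction. *)
Definition bne (x y : bits) : bool := has id (ar true false x y).1 || blt x y.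

Lemma nv_badd x y : nv (badd x y) = nv x + nv y.
Proof.
rewrite /badd -cats1 nv_cat /= double0 addn0.
by have := ar_add false x y; rewrite addn0.
Qed.

Lemma size_badd x y : size (badd x y) = (maxn (size x) (size y)).+1.
Proof. by rewrite size_rcons size_ar. Qed.

Lemma bltE x y : blt x y = (nv x < nv y).
Proof.
rewrite /blt; have := ar_sub false x y; have := nv_lt (ar true false x y).1.
by case: (ar true false x y) => z [] /=; move: (2 ^ _) => w; lia.
Qed.

Lemma nv_sub x y : nv y <= nv x -> nv (ar true false x y).1 = nv x - nv y.
Proof.
move=> yx; have := ar_sub false x y; rewrite -/(blt x y) bltE ltnNge yx /=.
by lia.
Qed.

Lemma bneE x y : bne x y = (nv x != nv y).
Proof.
rewrite /bne -[has _ _]negbK -nv_eq0 bltE; have := ar_sub false x y.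
rewrite -/(blt x y) bltE; case: ltngtP => [xy|yx|xy] /= E; first by rewrite orbT.
  by rewrite orbF; lia.
by rewrite orbF; lia.
Qed.

(* One step of schoolbook multiplication ([d = false]) or long division
   ([d = true]) by [y]; [st.1] is the partial product or the remainder,
   [st.2] collects the quotient. *)
Definition lstep (d : bool) (y : bits) (st : bits * bits) (a : bool) : bits * bits :=
  let r := (d && a) :: st.1 in
  let z := ar d false r y in
  let acc := if d then ~~ z.2 else a in
  (if acc then (if d then z.1 else rcons z.1 z.2) else r, acc :: st.2).

(** Horner's scheme: [rev x] supplies the most significant bit first, and prepending the quotient
    bits leaves the least significant one in front. *)
Definition long (d : bool) (x y : bits) : bits * bits :=
  foldl (lstep d y) ([::], [::]) (rev x).

Lemma long_cons d a x y : long d (a :: x) y = lstep d y (long d x y) a.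
Proof. by rewrite /long rev_cons -cats1 foldl_cat. Qed.

Lemma nv_mul x y : nv (long false x y).1 = nv x * nv y.
Proof.
elim: x => [|a x IH] //; rewrite long_cons /lstep /=.
case: a => /=; last by rewrite IH; lia.
by have := nv_badd (false :: (long false x y).1) y; rewrite /badd /= => ->; rewrite IH; lia.
Qed.

(** A remainder below y becomes less than 2y after doubling and appending a bit, so a single trial
    subtraction per step suffices. *)
Lemma long_div x y : 0 < nv y ->
  nv x = nv (long true x y).2 * nv y + nv (long true x y).1 /\ nv (long true x y).1 < nv y.
Proof.
move=> y0; elim: x => [|a x [IH1 IH2]] //; rewrite long_cons /lstep.
move: (long true x y) IH1 IH2 => [r q] /= IH1 IH2.
have := bltE (a :: r) y; have := @nv_sub (a :: r) y; rewrite /blt /=.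
case: ltnP => /= E H1 H2; rewrite ?H2 /= IH1; first by lia.
by rewrite H1 //; lia.
Qed.

Lemma size_long2 d x y : size (long d x y).2 = size x.
Proof. by elim: x => [|a x IH] //; rewrite long_cons /= IH. Qed.

(** Each step lengthens the partial product by at most one bit for the shift and one for the
    carry. *)
Lemma size_mul x y : size (long false x y).1 <= 2 * size x + size y.
Proof.
elim: x => [|a x IH] //; rewrite long_cons /lstep /=.
have := size_ar false false (false :: (long false x y).1) y => /=.
by case: a => //=; rewrite ?size_rcons ?size_ar /=; lia.
Qed.

(** Remainders are not trimmed: their lists grow with each shift although their values stay
    small. *)
Lemma size_rem x y : size (long true x y).1 <= size x + size y.
Proof.
elim: x => [|a x IH] //; rewrite long_cons /lstep /=.
have := size_ar true false (a :: (long true x y).1) y => /=.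
by case: (ar _ _ _ _).2 => //=; rewrite ?size_ar /=; lia.
Qed.

(** * Canonical binary representations *)

Definition canon (m : bits) : bool := (m == [:: false]) || head false m.

Definition rb (n : nat) : bits := rev (bin n).

Lemma binr_fuel f n : n < f -> binr f n = binr n.+1 n.
Proof.
elim/ltn_ind: n f => n IH [|f] //= nf.
case: (ltnP n 2) => // n2; congr cons.
have h : n./2 < n by rewrite -divn2 ltn_Pdiv //; lia.
by rewrite (IH _ h f) ?(IH _ h n) //; lia.
Qed.

Lemma rbE n : rb n = binr n.+1 n.
Proof. by rewrite /rb /bin revK. Qed.

Lemma rb_rec n : rb n = if n < 2 then [:: n == 1] else odd n :: rb n./2.
Proof.
rewrite !rbE [LHS]/=; case: (ltnP n 2) => // n2; congr cons.
by rewrite binr_fuel //; rewrite -divn2 ltn_Pdiv //; lia.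
Qed.

Lemma nv_rb n : nv (rb n) = n.
Proof.
elim/ltn_ind: n => n IH; rewrite rb_rec; case: (ltnP n 2) => n2 /=.
  by case: n n2 IH => [|[|n]].
rewrite IH ?odd_double_half //.
by rewrite -divn2 ltn_Pdiv //; lia.
Qed.

Lemma canon_bin n : canon (bin n).
Proof.
rewrite /canon -[bin n]revK -/(rb n).
elim/ltn_ind: n => n IH; rewrite rb_rec; case: (ltnP n 2) => n2 /=.
  by case: n n2 IH => [|[|n]].
have h : n./2 < n by rewrite -divn2 ltn_Pdiv //; lia.
apply/orP; right; case/orP: (IH _ h) => [/eqP E|].
  have := nv_rb n./2; rewrite -[rb _]revK E /=; lia.
rewrite rev_cons; by case: (rev _).
Qed.

(** A set top bit makes the value of every nonempty suffix positive, so the recursion [rb_rec] does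
    not stop early. *)
Lemma rb_nv u : last false u || (u == [:: false]) -> rb (nv u) = u.
Proof.
elim: u => [|b u IH] //=; case: u IH => [|c u] IH.
  by case: b; rewrite rb_rec.
move=> H0; have H : last c u by case/orP: H0 => // /eqP.
rewrite rb_rec.
have nz : 0 < nv (c :: u).
  rewrite lt0n nv_eq0 negbK; elim: u c {IH H0} H => [|e u IHu] c /= H; first by rewrite H.
  by have /= -> := IHu e H; rewrite orbT.
have {IH H0}E : rb (nv (c :: u)) = c :: u by apply: IH; rewrite /= H.
move: (nv (c :: u)) nz E => k nz E.
rewrite ifF; last by lia.
have -> : odd (b + k.*2) = b by case: (b); lia.
have -> : (b + k.*2)./2 = k by case: (b); lia.
by rewrite E.
Qed.

Lemma canonP m : canon m -> m = bin (nv (rev m)).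
Proof.
move=> H; rewrite -[bin _]revK -/(rb _) rb_nv ?revK //.
case/orP: H => [/eqP -> //|]; case: m => // b m /= ->.
by rewrite rev_cons last_rcons.
Qed.

(** * Evaluation of circuits on bit lists *)

(* Gate names with their values; the value [None] is the empty set. *)
Notation env := (seq (bits * option bits)).

(** [None] says that no gate has this name, [Some None] that its result set is empty. *)
Fixpoint lk (e : env) (k : bits) : option (option bits) :=
  if e is nx :: e' then if bne nx.1 k then lk e' k else Some nx.2 else None.

Definition opv (o : op) (u r : option bits) : option bits :=
  match u, r with
  | Some x, Some y =>
    match o with
    | OPlus => Some (badd x y)
    | OCap => if bne x y then None else Some x
    | OTimes => Some (long false x y).1
    | ODiv =>
      if bne y [::] then
        if bne (long true x y).1 [::] then None else Some (long true x y).2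
      else None
    | _ => None
    end
  | _, _ => None
  end.

Definition alw (tm : bool) (o : op) : bool :=
  match o with OCap | OPlus | ODiv => true | OTimes => tm | _ => false end.

Lemma opvP tm o (A B : nset) u r : alw tm o ->
  (forall x, A x <-> omap nv u = Some x) -> (forall x, B x <-> omap nv r = Some x) ->
  forall x, binop_sem o A B x <-> omap nv (opv o u r) = Some x.
Proof.
move=> Ho HA HB x.
case: u HA => [u|] HA; last first.
  split=> //; case: o Ho => //= _; first by case=> /HA.
  - by case=> a [b [/HA]].
  - by case=> a [b [/HA]].
  - by case=> a [b [/HA]].
case: r HB => [r|] HB; last first.
  split=> //; case: o Ho => //= _; first by case=> _ /HB.
  - by case=> a [b [_ [/HB]]].
  - by case=> a [b [_ [/HB]]].
  - by case=> a [b [_ [/HB]]].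
have {}HA y : A y <-> nv u = y by rewrite HA /=; split=> [[]|->].
have {}HB y : B y <-> nv r = y by rewrite HB /=; split=> [[]|->].
case: o Ho => //= _.
- rewrite bneE; case: eqP => /= E; split=> //.
  + by case=> /HA -> _.
  + by case=> <-; split; [apply/HA | apply/HB].
  + by case=> /HA ? /HB ?; case: E; congruence.
- rewrite nv_badd; split=> [[a [b [/HA <- [/HB <- ->]]]] //|[<-]].
  by exists (nv u), (nv r); split; [apply/HA | split; [apply/HB|]].
- rewrite nv_mul; split=> [[a [b [/HA <- [/HB <- ->]]]] //|[<-]].
  by exists (nv u), (nv r); split; [apply/HA | split; [apply/HB|]].
- rewrite !bneE /=; case: eqP => /= [r0|/eqP]; last rewrite -lt0n => r0.
    by split=> // -[a [b [_ [/HB <- []]]]].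
  have [E1 E2] := @long_div u r r0; rewrite E1 in HA.
  case: eqP => /= E; split=> //.
  + case=> a [b [/HA <- [/HB <- [_]]]]; rewrite E addn0 => /eqP.
    by rewrite eqn_pmul2r // => /eqP ->.
  + case=> <-; exists (nv u), (nv r); rewrite HA HB -E1; split=> //; split=> //.
    by split; [lia | rewrite E1 E addn0].
  + case=> a [b [/HA <- [/HB <- [_]]]] E3; case: E.
    (* If the quotient were exact, the remainder would be a multiple of the divisor; being smaller
       than it, it would vanish, against [E]. *)
    have : nv (long true u r).1 = (x - nv (long true u r).2) * nv r by nia.
    by nia.
Qed.

Definition evg (e : env) (g : gate) : option bits :=
  match g_label g, g_preds g with
  | LIn a, _ => Some (rb a)
  | LOp o, [:: p; q] =>
    opv o (odflt None (lk e (rb (minn p q)))) (odflt None (lk e (rb (maxn p q))))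
  | _, _ => None
  end.

Fixpoint evenv (gs : seq gate) : env :=
  if gs is g :: r then (rb (g_name g), evg (evenv r) g) :: evenv r else [::].

Lemma lk_evenv gs n : isSome (lk (evenv gs) (rb n)) = (n \in map g_name gs).
Proof.
elim: gs => [|g gs IH] //=; rewrite bneE !nv_rb inE [n == _]eq_sym.
by case: eqP.
Qed.

Section Spec.
Variables (O : op -> Prop) (tm : bool).
Hypothesis HO : forall o, O o <-> alw tm o.

Lemma gate_ok_op g o gs : gate_ok O g gs -> g_label g = LOp o ->
  alw tm o /\ exists p q, g_preds g = [:: p; q].
Proof.
case=> _ Hl E; rewrite E in Hl; case: o Hl {E} => -[/HO // Ho];
  by case: (g_preds g) => [|p [|q []]] // _; split=> //; exists p, q.
Qed.

Lemma sem_evenv gs n x : gates_ok O gs ->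
  sem gs n x <-> omap nv (odflt None (lk (evenv gs) (rb n))) = Some x.
Proof.
elim: gs n x => [|g gs IH] n x //= [Hg /IH{}IH].
rewrite bneE !nv_rb; case: eqP => //= _.
rewrite /gate_val /evg; case El: (g_label g) => [a|o].
  by rewrite /= nv_rb; split=> [->|[]].
have [Ho [p [q ->]]] := gate_ok_op Hg El.
have := opvP Ho (fun x => IH (minn p q) x) (fun x => IH (maxn p q) x) x.
by case: (o) Ho.
Qed.

(** * Reading the encoding from right to left *)

(* The part of the text to the right of the head is, in mode
   [Mb]: digits of b; [Mg]: | b; [Mq]: digits of the second predecessor or of
   an input label; [Mp]: digits of the first predecessor; [Mo]: complete
   predecessors, an operation must follow; [Ms]: complete label, a separator
   must follow; [Mn]: digits of a gate name; [Mout]: digits of the output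
   gate.  [bf] holds the digits of the current number, [lb], [pr], [qr] the
   label and the predecessors of the current gate, the input label being
   stored in [qr]. *)
Inductive mode := Mb | Mg | Mq | Mp | Mo | Ms | Mn | Mout.

Record st := St {
  md : mode; bf : bits; lb : seq esym; pr : bits; qr : bits; bv : bits; en : env }.

Definition st0 := St Mb [::] [::] [::] [::] [::] [::].

(** Distinctness of names and acyclicity are checked here, both by lookup: the new name must be
    absent from the table and the predecessors present. *)
Definition fin (lb : seq esym) (nm pr qr : bits) (en : env) : option env :=
  if lk en nm is Some _ then None else
  match lb with
  | [:: EIn] => Some ((nm, Some qr) :: en)
  | [:: EOp o] =>
    let k1 := if blt pr qr then pr else qr in
    let k2 := if blt pr qr then qr else pr in
    if lk en k1 is Some u then
      if lk en k2 is Some r then Some ((nm, opv o u r) :: en) else None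
    else None
  | _ => None
  end.

Definition isdig (m : mode) : bool :=
  match m with Mb | Mq | Mp | Mn | Mout => true | _ => false end.

Definition dgs (b : bool) : esym := if b then E1 else E0.
Notation digs := (map dgs).

Definition putdig (b : bool) (s : st) : option st :=
  if isdig (md s) then Some (St (md s) (b :: bf s) (lb s) (pr s) (qr s) (bv s) (en s))
  else None.

(** Reading leftwards, the end of a gate name shows only at the next symbol: the [EGate] of the
    preceding gate or the separator after the output gate. Hence the two continuations [m]. *)
Definition close (m : mode) (s : st) : option st :=
  if canon (bf s) then
    omap (St m [::] [::] [::] [::] (bv s)) (fin (lb s) (rev (bf s)) (pr s) (qr s) (en s))
  else None.

Definition step1 (s : st) (x : esym) : option st :=
  let: St m bf lb pr qr bv en := s in
  match x, m with
  | E0, _ => putdig false s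
  | E1, _ => putdig true s
  | ESep, Mb => if canon bf then Some (St Mg [::] lb pr qr (rev bf) en) else None
  | ESep, Mg => Some (St Mout bf lb pr qr bv en)
  | ESep, Mq => if canon bf then Some (St Mp [::] lb pr (rev bf) bv en) else None
  | ESep, Mp => if canon bf then Some (St Mo [::] lb (rev bf) qr bv en) else None
  | ESep, Ms => Some (St Mn bf lb pr qr bv en)
  | ESep, Mn => close Mout s
  | EGate, Mg => Some (St Mq bf lb pr qr bv en)
  | EGate, Mn => close Mq s
  | EIn, Mq => if canon bf then Some (St Ms [::] [:: EIn] pr (rev bf) bv en) else None
  | EOp o, Mo => if alw tm o then Some (St Ms bf [:: EOp o] pr qr bv en) else None
  | _, _ => None
  end.

Definition parse (t : seq esym) : option st :=
  foldr (fun x o => obind (step1 ^~ x) o) (Some st0) t.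

Definition body (gs : seq gate) (b : nat) : seq esym :=
  flatten (map gate_syms gs) ++ ESep :: enum_syms b.

Definition lsyms (l : label) (ps : seq nat) : seq esym :=
  label_syms l ++ flatten (map (fun p => ESep :: enum_syms p) ps).

Lemma enum_symsE n : enum_syms n = digs (bin n).
Proof. by []. Qed.

Lemma canon_enum m : canon m -> digs m = enum_syms (nv (rev m)).
Proof. by move=> /canonP E; rewrite enum_symsE -E. Qed.

Lemma canon_rb m : canon m -> rev m = rb (nv (rev m)).
Proof. by move=> /canonP E; rewrite /rb -E. Qed.

Lemma body_cons g gs b :
  body (g :: gs) b =
  enum_syms (g_name g) ++ ESep :: lsyms (g_label g) (g_preds g) ++ EGate :: body gs b.
Proof. by rewrite /body /gate_syms /lsyms /= -!catA /= -!catA. Qed.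

Definition good (gs : seq gate) := uniq (map g_name gs) /\ gates_ok O gs.

Definition lab_ok (l : label) (ps : seq nat) lb pr qr : Prop :=
  (exists a, [/\ l = LIn a, ps = [::], lb = [:: EIn], pr = [::] & qr = rb a]) \/
  (exists o p q, [/\ l = LOp o, ps = [:: p; q], lb = [:: EOp o],
                     pr = rb p /\ qr = rb q & alw tm o]).

Lemma gate_label_ok gs n l ps : gate_ok O (Gate n l ps) gs ->
  exists lb pr qr, lab_ok l ps lb pr qr.
Proof.
case: l => [a [_ /= ->]|o Hg]; first by exists [:: EIn], [::], (rb a); left; exists a.
have [Ho [p [q /= ->]]] := gate_ok_op Hg erefl.
by exists [:: EOp o], (rb p), (rb q); right; exists o, p, q.
Qed.

Lemma fin_sound gs n l ps lb pr qr e : good gs -> lab_ok l ps lb pr qr ->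
  fin lb (rb n) pr qr (evenv gs) = Some e ->
  good (Gate n l ps :: gs) /\ e = evenv (Gate n l ps :: gs).
Proof.
move=> [Hu Hg] Hl; rewrite /fin.
have := lk_evenv gs n; case: (lk _ (rb n)) => //= Hn.
case: Hl => [[a [-> -> -> _ ->]] [<-]|[o [p [q [-> -> -> [-> ->] Ho]]]]].
  by split=> //; split; rewrite /= -?Hn //; split.
rewrite bltE !nv_rb.
have -> : (if p < q then rb p else rb q) = rb (minn p q) by rewrite /minn; case: ltnP.
have -> : (if p < q then rb q else rb p) = rb (maxn p q) by rewrite /maxn; case: ltnP.
have := lk_evenv gs (minn p q); case E1: (lk _ _) => [u|] //= M1.
have := lk_evenv gs (maxn p q); case E2: (lk _ _) => [r|] //= M2 [<-].
split; last by rewrite /evg /= E1 E2.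
split; rewrite /= -?Hn //; split=> //; split.
  move=> k; rewrite !inE; move: M1 M2; rewrite /minn /maxn.
  by case: ltnP => _ M1 M2 /orP[] /eqP ->; rewrite -?M1 -?M2.
by case: (o) Ho => //= Ho; split=> //; apply/HO.
Qed.

Lemma fin_complete gs n l ps lb pr qr : good (Gate n l ps :: gs) ->
  lab_ok l ps lb pr qr ->
  fin lb (rb n) pr qr (evenv gs) = Some (evenv (Gate n l ps :: gs)).
Proof.
move=> [/= /andP[Hn Hu] [[Hp Hl] Hg]]; rewrite /fin.
have := lk_evenv gs n; rewrite (negbTE Hn); case: (lk _ (rb n)) => //= _.
case=> [[a [-> -> -> _ ->]] //|[o [p [q [El Ep -> [-> ->] Ho]]]]].
rewrite bltE !nv_rb.
have -> : (if p < q then rb p else rb q) = rb (minn p q) by rewrite /minn; case: ltnP.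
have -> : (if p < q then rb q else rb p) = rb (maxn p q) by rewrite /maxn; case: ltnP.
have Mp : p \in map g_name gs by apply: Hp; rewrite /= Ep inE eqxx.
have Mq : q \in map g_name gs by apply: Hp; rewrite /= Ep !inE eqxx orbT.
have M1 : minn p q \in map g_name gs by rewrite /minn; case: ifP.
have M2 : maxn p q \in map g_name gs by rewrite /maxn; case: ifP.
rewrite /evg /= El Ep.
have := lk_evenv gs (minn p q); rewrite M1; case: (lk _ _) => //= u _.
by have := lk_evenv gs (maxn p q); rewrite M2; case: (lk _ _).
Qed.

(** Exhibits the text read so far as the encoding of a good list of gates preceded by an unfinished
    gate. This is what rebuilds a circuit from an accepted word. *)
Definition inv (t : seq esym) (s : st) : Prop :=
  let: St m bf lb pr qr bv en := s in
  if m is Mb then [/\ t = digs bf, lb = [::], pr = [::], qr = [::] & en = [::]] else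
  exists gs b, [/\ good gs, bv = rb b, en = evenv gs &
    match m with
    | Mb => False
    | Mg => [/\ gs = [::], t = body gs b, bf = [::], lb = [::] & pr = [::] /\ qr = [::]]
    | Mq => [/\ t = digs bf ++ EGate :: body gs b, lb = [::], pr = [::] & qr = [::]]
    | Mp => exists q, [/\ t = digs bf ++ ESep :: enum_syms q ++ EGate :: body gs b,
                          lb = [::], pr = [::] & qr = rb q]
    | Mo => exists p q,
        [/\ t = ESep :: enum_syms p ++ ESep :: enum_syms q ++ EGate :: body gs b,
            bf = [::], lb = [::], pr = rb p & qr = rb q]
    | Ms => bf = [::] /\ exists l ps, lab_ok l ps lb pr qr /\
              t = lsyms l ps ++ EGate :: body gs b
    | Mn => exists l ps, lab_ok l ps lb pr qr /\
              t = digs bf ++ ESep :: lsyms l ps ++ EGate :: body gs b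
    | Mout => [/\ t = digs bf ++ ESep :: body gs b, lb = [::], pr = [::] & qr = [::]]
    end].

Lemma putdig_inv t s b s' : inv t s -> putdig b s = Some s' -> inv (dgs b :: t) s'.
Proof.
case: s => -[] //= bf lb pr qr bv en; rewrite /putdig /=.
- by case=> -> -> -> -> -> [<-].
- move=> [gs [c [Hg -> -> [-> -> -> ->]]]] [<-].
  by exists gs, c.
- move=> [gs [c [Hg -> -> [q [-> -> -> ->]]]]] [<-].
  by exists gs, c; split=> //; exists q.
- move=> [gs [c [Hg -> -> [l [ps [Hl ->]]]]]] [<-].
  by exists gs, c; split=> //; exists l, ps.
- move=> [gs [c [Hg -> -> [-> -> -> ->]]]] [<-].
  by exists gs, c.
Qed.

Lemma close_inv t m s s' : inv t s -> md s = Mn -> close m s = Some s' ->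
  exists gs b, [/\ good gs, t = body gs b &
    s' = St m [::] [::] [::] [::] (rb b) (evenv gs)].
Proof.
case: s => m' bf lb pr qr bv en /=; case: m' => //.
case=> gs [b [Hg -> -> [l [ps [Hl ->]]]]] _; rewrite /close /=.
case: ifP => // Hc; rewrite (canon_rb Hc).
case E: (fin _ _ _ _ _) => [e|] //= [<-].
have [Hg' ->] := fin_sound Hg Hl E; exists (Gate (nv (rev bf)) l ps :: gs), b.
by rewrite body_cons (canon_enum Hc).
Qed.

Lemma step1_inv t s x s' : inv t s -> step1 s x = Some s' -> inv (x :: t) s'.
Proof.
case: x => [|||||o].
- by move=> Hi E; apply: (putdig_inv (b := false) Hi); case: s E {Hi}.
- by move=> Hi E; apply: (putdig_inv (b := true) Hi); case: s E {Hi}.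
- case: s => m bf lb pr qr bv en; case: m => //.
  + move=> /= [-> -> -> -> ->]; case: ifP => // Hc [<-].
    exists [::], (nv (rev bf)); split=> //; first exact: canon_rb.
    by rewrite /body -(canon_enum Hc).
  + case=> gs [b [Hg -> -> [Eg -> -> -> [-> ->]]]] [<-].
    by exists gs, b; split.
  + case=> gs [b [Hg -> -> [-> -> -> ->]]] /=; case: ifP => // Hc [<-].
    exists gs, b; split=> //; exists (nv (rev bf)).
    by rewrite -(canon_enum Hc) -(canon_rb Hc).
  + case=> gs [b [Hg -> -> [q [-> -> -> ->]]]] /=; case: ifP => // Hc [<-].
    exists gs, b; split=> //; exists (nv (rev bf)), q.
    by rewrite -(canon_enum Hc) -(canon_rb Hc).
  + case=> gs [b [Hg -> -> [-> [l [ps [Hl ->]]]]]] /= [<-].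
    by exists gs, b; split=> //; exists l, ps.
  + move=> Hi /(close_inv Hi) [] // gs [b [Hg -> ->]].
    by exists gs, b.
- case: s => m bf lb pr qr bv en; case: m => //.
  + case=> gs [b [Hg -> -> [Eg -> -> -> [-> ->]]]] [<-].
    by exists gs, b; split.
  + move=> Hi /(close_inv Hi) [] // gs [b [Hg -> ->]].
    by exists gs, b.
- case: s => m bf lb pr qr bv en; case: m => //.
  case=> gs [b [Hg -> -> [-> -> -> ->]]] /=; case: ifP => // Hc [<-].
  exists gs, b; split=> //; split=> //; exists (LIn (nv (rev bf))), [::].
  split; last by rewrite /lsyms /= cats0 -(canon_enum Hc).
  by left; exists (nv (rev bf)); split=> //; apply: canon_rb.
- case: s => m bf lb pr qr bv en; case: m => //.
  case=> gs [b [Hg -> -> [p [q [-> -> -> -> ->]]]]] /=; case: ifP => // Ho [<-].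
  exists gs, b; split=> //; split=> //; exists (LOp o), [:: p; q].
  split; first by right; exists o, p, q.
  by rewrite /lsyms /= cats0 -!catA.
Qed.

Lemma parse_inv t s : parse t = Some s -> inv t s.
Proof.
elim: t s => [|x t IH] s /=; first by case=> <-.
by case E: (parse t) => [s1|] //= /step1_inv; apply; apply: IH.
Qed.

Lemma parse_digs u t m lb pr qr bv en : isdig m ->
  parse t = Some (St m [::] lb pr qr bv en) ->
  parse (digs u ++ t) = Some (St m u lb pr qr bv en).
Proof.
move=> Hm Ht; elim: u => [|b u IH] //=; rewrite -/(parse _) IH /=.
by case: b; rewrite /= /putdig /= Hm.
Qed.

Lemma parse_cons x t s : parse t = Some s -> parse (x :: t) = step1 s x.
Proof. by rewrite /= -/(parse t) => ->. Qed.

(** The symbol [x] is included because the leftmost gate enters the table only when [x] is read. In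
    the induction the remaining gates are closed by the [EGate] that ends the gate in front of
    them. *)
Lemma parse_close gs b x m : good gs ->
  (x = EGate /\ m = Mq) \/ (x = ESep /\ m = Mout) ->
  parse (x :: body gs b) = Some (St m [::] [::] [::] [::] (rb b) (evenv gs)).
Proof.
elim: gs x m => [|[n l ps] gs IH] x m Hg Hx.
  have E : parse (enum_syms b) = Some (St Mb (bin b) [::] [::] [::] [::] [::]).
    by rewrite enum_symsE -[digs _]cats0; apply: parse_digs.
  have {}E : parse (body [::] b) = Some (St Mg [::] [::] [::] [::] (rb b) [::]).
    by rewrite /body [_ ++ _]/= (parse_cons _ E) /= canon_bin.
  by rewrite (parse_cons _ E); case: Hx => -[-> ->].
have [Hu [Hok Hgs]] := Hg; have Hg' : good gs by split=> //; case/andP: Hu.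
have {IH}E := IH EGate Mq Hg' (or_introl (conj erefl erefl)).
have [lb [pr [qr Hl]]] := gate_label_ok Hok.
have {}E : parse (ESep :: lsyms l ps ++ EGate :: body gs b)
    = Some (St Mn [::] lb pr qr (rb b) (evenv gs)).
  case: Hl => [[a [-> -> -> -> ->]]|[o [p [q [-> -> -> [-> ->] Ho]]]]].
    have E1 := parse_digs (bin a) (m := Mq) isT E.
    have -> : lsyms (LIn a) [::] ++ EGate :: body gs b = EIn :: digs (bin a) ++ EGate :: body gs b.
      by rewrite /lsyms /= cats0.
    rewrite (@parse_cons _ _ (St Ms [::] [:: EIn] [::] (rb a) (rb b) (evenv gs))) //.
    by rewrite (parse_cons _ E1) /= canon_bin.
  have E1 := parse_digs (bin q) (m := Mq) isT E.
  have {E1}E2 : parse (ESep :: digs (bin q) ++ EGate :: body gs b)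
      = Some (St Mp [::] [::] [::] (rb q) (rb b) (evenv gs)).
    by rewrite (parse_cons _ E1) /= canon_bin.
  have {E2}E3 := parse_digs (bin p) (m := Mp) isT E2.
  have -> : lsyms (LOp o) [:: p; q] ++ EGate :: body gs b
      = EOp o :: ESep :: digs (bin p) ++ ESep :: digs (bin q) ++ EGate :: body gs b.
    by rewrite /lsyms /= cats0 -!catA.
  rewrite (@parse_cons _ _ (St Ms [::] [:: EOp o] (rb p) (rb q) (rb b) (evenv gs))) //.
  rewrite (@parse_cons _ _ (St Mo [::] [::] (rb p) (rb q) (rb b) (evenv gs))) /= ?Ho //.
  by rewrite -/(parse _) E3 /= canon_bin.
have {}E := parse_digs (bin n) (m := Mn) isT E.
have F := fin_complete Hg Hl.
rewrite body_cons enum_symsE (parse_cons _ E).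
by case: Hx => -[-> ->]; rewrite /= /close /= canon_bin /= -/(rb n) F.
Qed.

Definition accept (s : st) : bool :=
  if s is St Mout bf _ _ _ bv en then
    canon bf && (if lk en (rev bf) is Some (Some v) then ~~ bne v bv else false)
  else false.

Definition text (C : circuit) (b : nat) : seq esym :=
  enum_syms (c_out C) ++ ESep :: body (c_gates C) b.

Lemma parse_text C b : valid_circuit O C ->
  exists2 s, parse (text C b) = Some s & accept s <-> I_C C b.
Proof.
case=> Hu [Ho Hg].
have E := parse_close b (conj Hu Hg) (or_intror (conj erefl erefl)).
have {}E := parse_digs (bin (c_out C)) (m := Mout) isT E.
exists (St Mout (bin (c_out C)) [::] [::] [::] (rb b) (evenv (c_gates C))) => //.
rewrite /I_C sem_evenv //= canon_bin -/(rb _).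
case: (lk _ _) => [[v|]|] //=; rewrite bneE nv_rb negbK.
by split=> [/eqP ->|[->]].
Qed.

Lemma accept_text t s : parse t = Some s -> accept s ->
  exists C b, [/\ valid_circuit O C, t = text C b & I_C C b].
Proof.
move=> Hp Ha; have := parse_inv Hp; case: s Hp Ha => -[] // bf lb pr qr bv en Hp.
rewrite /= => /andP[Hc Ha] [gs [b [[Hu Hg] Hb He [Ht _ _ _]]]].
move: Ha; rewrite (canon_rb Hc) He; set n := nv (rev bf).
have := lk_evenv gs n; case E: (lk _ _) => [[v|]|] //= M.
rewrite Hb bneE nv_rb negbK => /eqP Hv; exists (Circuit gs n), b; split.
- by split=> //; split=> //=; rewrite -M.
- by rewrite Ht (canon_enum Hc).
- by rewrite /I_C sem_evenv //= E /= Hv.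
Qed.

(** * Reading bits *)

Definition dec4 (a b c d : bool) : option esym :=
  match a, b, c, d with
  | false, false, false, false => Some E0
  | false, false, false, true => Some E1
  | false, false, true, false => Some ESep
  | false, false, true, true => Some EGate
  | false, true, false, false => Some EIn
  | false, true, false, true => Some (EOp OCup)
  | false, true, true, false => Some (EOp OCap)
  | false, true, true, true => Some (EOp OCompl)
  | true, false, false, false => Some (EOp OPlus)
  | true, false, false, true => Some (EOp OTimes)
  | true, false, true, false => Some (EOp ODiv)
  | _, _, _, _ => None
  end.

Lemma dec4_code a b c d x : dec4 a b c d = Some x <-> esym_code x = [:: a; b; c; d].
Proof.
split; first by case: a b c d => [] [] [] [] //= [<-].
by case: x => [|||||[]] [<- <- <- <-].
Qed.

Definition stepb (ts : bits * st) (a : bool) : option (bits * st) :=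
  match ts.1 with
  | [:: b; c; d] =>
    if dec4 a b c d is Some x then omap (pair [::]) (step1 ts.2 x) else None
  | t4 => Some (a :: t4, ts.2)
  end.

Definition parseb (w : bits) : option (bits * st) :=
  foldr (fun a o => obind (stepb ^~ a) o) (Some ([::], st0)) w.

Lemma parseb_sound w t4 s : parseb w = Some (t4, s) ->
  exists t, [/\ w = t4 ++ flatten (map esym_code t), parse t = Some s & size t4 < 4].
Proof.
elim: w t4 s => [|a w IH] t4 s /=; first by case=> <- <-; exists [::].
case E: (parseb w) => [[u s1]|] //=; have [t [-> Ht]] := IH _ _ E.
case: u {E} => [|b [|c [|d [|e u]]]] // _.
- by case=> <- <-; exists t.
- by case=> <- <-; exists t.
- by case=> <- <-; exists t.
rewrite /stepb /=; case E: (dec4 _ _ _ _) => [x|] //=.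
case E1: (step1 s1 x) => [s2|] //= [<- <-]; exists (x :: t); split=> //.
  by move/dec4_code: E => /= ->.
by rewrite (parse_cons _ Ht).
Qed.

Lemma parseb_complete t s : parse t = Some s ->
  parseb (flatten (map esym_code t)) = Some ([::], s).
Proof.
elim: t s => [|x t IH] s /=; first by case=> <-.
case E: (parse t) => [s1|] //= E1.
have [a [b [c [d Ex]]]] : exists a b c d, esym_code x = [:: a; b; c; d].
  by case: (x) => [|||||[]]; do 4 eexists.
rewrite Ex /= -/(parseb _) (IH _ E) /= /stepb /=.
by move/dec4_code: Ex => ->; rewrite E1.
Qed.

Definition decide (w : bits) : bool :=
  if parseb w is Some ([::], s) then accept s else false.

Lemma enc_text C b : enc C b = flatten (map esym_code (text C b)).
Proof. by []. Qed.

Lemma decideP w : decide w <-> MC O w.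
Proof.
rewrite /decide; split=> [|[C [b [Hv [-> Hb]]]]]; last first.
  have [s Hp Ha] := parse_text b Hv.
  by rewrite enc_text (parseb_complete Hp); apply/Ha.
case E: (parseb w) => [[[|//] s]|] // Ha.
have [t [-> Hp _]] := parseb_sound E.
have [C [b [Hv -> Hb]]] := accept_text Hp Ha.
by exists C, b.
Qed.

End Spec.

(** * Alphabet and registers of the evaluator *)

Notation digs := (map dgs).

Definition esym_tuple (x : esym) : bool * bool * bool * bool :=
  if esym_code x is [:: a; b; c; d] then (a, b, c, d) else (true, true, true, true).
Definition tuple_esym (t : bool * bool * bool * bool) : option esym :=
  let: (a, b, c, d) := t in dec4 a b c d.
Lemma esym_tupleK : pcancel esym_tuple tuple_esym.
Proof. by case=> [|||||[]]. Qed.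
HB.instance Definition _ := Finite.copy esym (pcan_type esym_tupleK).

Inductive reg :=
  | rIN | rT4 | rMODE | rBUF | rLAB | rPR | rQR | rBV | rENV | rENV2 | rX | rY | rZ
  | rC | rF | rT | rSEL | rFND | rRES | rKEY | rU | rA | rB | rR | rQ | rV | rNM
  | rBAD | rACC.

Definition reg_list := [:: rIN; rT4; rMODE; rBUF; rLAB; rPR; rQR; rBV; rENV; rENV2;
  rX; rY; rZ; rC; rF; rT; rSEL; rFND; rRES; rKEY; rU; rA; rB; rR; rQ; rV; rNM;
  rBAD; rACC].

Definition reg_idx (r : reg) : nat :=
  match r with
  | rIN => 0 | rT4 => 1 | rMODE => 2 | rBUF => 3 | rLAB => 4 | rPR => 5 | rQR => 6
  | rBV => 7 | rENV => 8 | rENV2 => 9 | rX => 10 | rY => 11 | rZ => 12 | rC => 13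
  | rF => 14 | rT => 15 | rSEL => 16 | rFND => 17 | rRES => 18 | rKEY => 19
  | rU => 20 | rA => 21 | rB => 22 | rR => 23 | rQ => 24 | rV => 25 | rNM => 26
  | rBAD => 27 | rACC => 28
  end.
Definition reg_ord (r : reg) : 'I_29 := inord (reg_idx r).
Definition ord_reg (i : 'I_29) : reg := nth rIN reg_list i.
Lemma reg_ordK : cancel reg_ord ord_reg.
Proof. by case; rewrite /ord_reg /reg_ord inordK. Qed.
HB.instance Definition _ := Finite.copy reg (can_type reg_ordK).

Notation state := (reg -> seq esym).
Notation sprog := (prog reg esym).

(** Comparison by [reg_idx] reduces on concrete registers, unlike the equality transported through
    [inord]; most side conditions below then hold by computation. *)
Definition sset (s : state) (r : reg) (v : seq esym) : state :=
  fun r' => if reg_idx r' == reg_idx r then v else s r'.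

Lemma reg_idx_inj : injective reg_idx.
Proof. by move=> r r' E; rewrite -(reg_ordK r) -(reg_ordK r') /reg_ord E. Qed.

Lemma updE (s : state) (r : reg) (v : seq esym) : upd s r v = sset s r v.
Proof.
apply: functional_extensionality => r'; rewrite /upd /sset; congr (if _ then _ else _).
apply/eqP/eqP => [-> //|E].
exact: reg_idx_inj.
Qed.

Lemma sset_id (s : state) r : sset s r (s r) = s.
Proof. by rewrite -updE upd_id. Qed.

Lemma sset_eq (s : state) r v : sset s r v r = v.
Proof. by rewrite /sset eqxx. Qed.

Lemma skipE B Q (s : state) : wpre B (Skip _ _) Q s = Q s.
Proof. exact: wp_skipE. Qed.
Lemma pushE B (r : reg) (x : esym) Q (s : state) :
  wpre B (Push r x) Q s = (size (s r) < B /\ Q (sset s r (x :: s r))).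
Proof. by rewrite wp_pushE updE. Qed.
Lemma caseE B (r : reg) (f : option esym -> sprog) Q (s : state) :
  wpre B (Case r f) Q s = wpre B (f (ohead (s r))) Q (sset s r (behead (s r))).
Proof. by rewrite wp_caseE updE. Qed.
Lemma seqE B (p q : sprog) Q (s : state) : wpre B (Seq p q) Q s = wpre B p (wpre B q Q) s.
Proof. exact: wp_seqE. Qed.
Definition wpE := (skipE, pushE, caseE, seqE).

Lemma loopP B (I : seq esym -> state -> Prop) (r : reg) (f : esym -> sprog)
    (Q : state -> Prop) (s : state) :
  I (s r) s ->
  (forall s, s r = [::] -> I [::] s -> Q s) ->
  (forall x l s, s r = x :: l -> I (x :: l) s ->
     wpre B (f x) (fun s' => s' r = l /\ I l s') (sset s r l)) ->
  wpre B (Loop r f) Q s.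
Proof.
move=> I0 IQ IS; apply: (wp_loop I0 IQ) => x l s' E H.
by rewrite updE; apply: IS.
Qed.

Ltac gst_eq := apply: functional_extensionality => ?; rewrite /sset;
  repeat match goal with |- context [reg_idx ?r == reg_idx ?i] =>
    case: (reg_idx r =P reg_idx i) => [/reg_idx_inj ?|?]; subst end;
  try congruence.
Ltac st_eq := apply: functional_extensionality; case; rewrite /sset /=.

(** * Subroutines *)

Definition flag (b : bool) : seq esym := if b then [:: E1] else [::].
Definition is1 (x : esym) : bool := if x is E1 then true else false.

Lemma is1_dgs b : is1 (dgs b) = b. Proof. by case: b. Qed.

Definition clearp (i : reg) : sprog := Loop i (fun _ => Skip _ _).
(** A single move reverses the content; [mvp] and [copyp] pass through [rT] to keep the order. *)
Definition movep (i j : reg) : sprog := Loop i (fun x => Push j x).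
Definition mvp (i j : reg) : sprog := Seq (movep i rT) (movep rT j).
Definition copyp (i j : reg) : sprog :=
  Seq (movep i rT) (Loop rT (fun x => Seq (Push i x) (Push j x))).
Definition setf (r : reg) : sprog := Case r (fun _ => Push r E1).

Definition lbok (tm : bool) (l : seq esym) : bool :=
  match l with [::] | [:: EIn] => true | [:: EOp o] => alw tm o | _ => false end.

Definition envok (n V : nat) (e : env) : bool :=
  all (fun nx => (size nx.1 <= n) && (size (odflt [::] nx.2) <= V)) e.

Lemma lk_envok n V e k v : envok n V e -> lk e k = Some v -> size (odflt [::] v) <= V.
Proof.
elim: e => [|[m u] e IH] //= /andP[/andP[_ Hu] He].
by case: ifP => _; [exact: IH | case=> <-].
Qed.

(** A product has at most 2V + V bits by [size_mul]; the additional 1 covers a sum when V = 0. *)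
Lemma size_opv tm n V o u r : alw tm o -> n <= V ->
  size (odflt [::] u) <= V -> size (odflt [::] r) <= V ->
  size (odflt [::] (opv o u r)) <= if tm then 3 * V + 1 else V.+1.
Proof.
case: u => [u|]; case: r => [r|] //=; case: o => //= Ho _ Hu Hr.
- by case: ifP => _ /=; case: tm {Ho}; lia.
- by rewrite size_badd; case: tm {Ho}; lia.
- by have := size_mul u r; rewrite Ho; lia.
- do 2 case: ifP => _ //=.
  by rewrite size_long2; case: tm {Ho}; lia.
Qed.

Section Subroutines.
Variable B : nat.
Hypothesis B8 : 8 <= B.
Notation wp := (wpre B).

Lemma wp_clear i Q s : Q (sset s i [::]) -> wp (clearp i) Q s.
Proof.
move=> HQ; apply: (loopP (I := fun _ s' => Q (sset s' i [::]))) => //.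
  by move=> s' E; rewrite -E sset_id.
move=> x l s' E H; rewrite wpE sset_eq; split=> //.
by move: H; congr Q; gst_eq.
Qed.

Lemma sset_ne (s : state) i j v : i <> j -> sset s i v j = s j.
Proof. by move=> ij; rewrite /sset; case: eqP => [/reg_idx_inj E|//]; congruence. Qed.

Lemma wp_move i j Q s : i <> j -> size (s i) + size (s j) <= B ->
  Q (sset (sset s i [::]) j (catrev (s i) (s j))) -> wp (movep i j) Q s.
Proof.
move=> ij Hs HQ; have ji : j <> i by congruence.
apply: (loopP (I := fun l s' => size l + size (s' j) <= B /\
          Q (sset (sset s' i [::]) j (catrev l (s' j))))) => //.
  by move=> s' E [_]; congr Q; gst_eq.
move=> x l s' E [/= Hl HQ']; rewrite wpE !(sset_ne _ _ ij, sset_ne _ _ ji, sset_eq).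
split; first by lia.
split=> //; split; first by rewrite /=; lia.
by move: HQ'; congr Q; gst_eq.
Qed.

Lemma wp_mv2 i j Q s : i <> j -> i <> rT -> j <> rT -> s rT = [::] ->
  size (s i) + size (s j) <= B ->
  Q (sset (sset s i [::]) j (s i ++ s j)) -> wp (mvp i j) Q s.
Proof.
move=> ij iT jT sT Hs HQ; rewrite wpE; apply: wp_move => //.
  by rewrite sT /=; lia.
have Tj : rT <> j by congruence.
apply: wp_move => //.
  by rewrite sset_eq !(sset_ne _ _ Tj, sset_ne _ _ ij) catrevE sT cats0 size_rev.
rewrite sset_eq !(sset_ne _ _ Tj, sset_ne _ _ ij) !catrevE sT cats0 revK.
by move: HQ; congr Q; gst_eq.
Qed.

Lemma wp_copy i j Q s : i <> j -> i <> rT -> j <> rT -> s rT = [::] ->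
  size (s i) + size (s j) <= B ->
  Q (sset s j (s i ++ s j)) -> wp (copyp i j) Q s.
Proof.
move=> ij iT jT sT Hs HQ; rewrite wpE; apply: wp_move => //.
  by rewrite sT /=; lia.
have ji : j <> i by congruence.
have Ti : rT <> i by congruence.
have Tj : rT <> j by congruence.
apply: (loopP (I := fun l s' => [/\ size l + size (s' i) <= B,
   size l + size (s' j) <= B &
   Q (sset (sset (sset s' rT [::]) i (catrev l (s' i))) j (catrev l (s' j)))])).
- rewrite !(sset_ne _ _ ij, sset_ne _ _ ji, sset_ne _ _ Ti, sset_ne _ _ Tj,
    sset_ne _ _ iT, sset_ne _ _ jT, sset_eq) // catrevE sT cats0 size_rev; split=> //.
    by rewrite addn0; lia.
  rewrite !catrevE revK !cats0.
  by move: HQ; congr Q; gst_eq.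
- by move=> s' E [_ _]; congr Q; gst_eq.
- move=> x l s' E [/= Hi Hj HQ'].
  rewrite !wpE !(sset_ne _ _ ij, sset_ne _ _ ji, sset_ne _ _ Ti, sset_ne _ _ Tj,
    sset_ne _ _ iT, sset_ne _ _ jT, sset_eq).
  do 2 (split; first by lia); split=> //; split; try by rewrite /=; lia.
  by move: HQ'; congr Q; gst_eq.
Qed.

Lemma wp_setf r b Q s : s r = flag b -> Q (sset s r [:: E1]) -> wp (setf r) Q s.
Proof.
move=> E HQ; rewrite /setf !wpE E sset_eq.
have -> : behead (flag b) = [::] by case: (b).
split; first by rewrite /=; lia.
by move: HQ; congr Q; gst_eq.
Qed.

Definition cellp (d x y : bool) : sprog :=
  Case rC (fun oc => let c := isSome oc in
    Seq (Push rZ (dgs (abit x y c))) (if acar d x y c then Push rC E1 else Skip _ _)).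

Lemma wp_cellp d x y c Q s : s rC = flag c -> size (s rZ) < B ->
  Q (sset (sset s rZ (dgs (abit x y c) :: s rZ)) rC (flag (acar d x y c))) ->
  wp (cellp d x y) Q s.
Proof.
move=> E Hz HQ; rewrite /cellp !wpE E.
have -> : behead (flag c) = [::] by case: (c).
have -> : isSome (ohead (flag c)) = c by case: (c).
rewrite /sset /=; split=> //.
move: HQ; case: acar => /= HQ; rewrite wpE.
  rewrite /sset /=; split; first by lia.
  by move: HQ; congr Q; st_eq.
by move: HQ; congr Q; st_eq.
Qed.

Definition arith0 (d : bool) : sprog := Loop rY (fun y => cellp d false (is1 y)).
Definition arith (d : bool) : sprog :=
  Seq (Loop rX (fun x => Case rY (fun oy =>
         cellp d (is1 x) (if oy is Some y then is1 y else false))))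
      (arith0 d).

Lemma wp_arith0 d c y Q s : s rY = digs y -> s rC = flag c ->
  size y + size (s rZ) <= B ->
  Q (sset (sset (sset s rY [::]) rC (flag (ar0 d c y).2))
         rZ (catrev (digs (ar0 d c y).1) (s rZ))) ->
  wp (arith0 d) Q s.
Proof.
move=> Ey Ec Hs HQ.
apply: (loopP (I := fun l s => exists y c, [/\ l = digs y, s rC = flag c,
  size y + size (s rZ) <= B &
  Q (sset (sset (sset s rY [::]) rC (flag (ar0 d c y).2))
         rZ (catrev (digs (ar0 d c y).1) (s rZ)))])).
- by exists y, c.
- move=> s' E [[|? ?] [c' [//= _ Ec' _ HQ']]].
  by move: HQ'; congr Q; st_eq.
- move=> x l s' E [[|b y'] [c' [//= [-> ->] Ec' Hs' HQ']]].
  rewrite is1_dgs; apply: (wp_cellp (c := c')); rewrite /sset //=; first by lia.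
  split=> //; exists y', (acar d false b c'); rewrite /sset /=; split=> //; first by lia.
  by move: HQ'; congr Q; st_eq.
Qed.

Lemma wp_arith d c x y Q s : s rX = digs x -> s rY = digs y -> s rC = flag c ->
  maxn (size x) (size y) + size (s rZ) <= B ->
  Q (sset (sset (sset (sset s rX [::]) rY [::]) rC (flag (ar d c x y).2))
         rZ (catrev (digs (ar d c x y).1) (s rZ))) ->
  wp (arith d) Q s.
Proof.
move=> Ex Ey Ec Hs HQ; rewrite /arith wpE.
apply: (loopP (I := fun l s => exists x y c,
  [/\ l = digs x, s rY = digs y, s rC = flag c,
  maxn (size x) (size y) + size (s rZ) <= B &
  Q (sset (sset (sset (sset s rX [::]) rY [::]) rC (flag (ar d c x y).2))
         rZ (catrev (digs (ar d c x y).1) (s rZ)))])).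
- by exists x, y, c.
- move=> s' E [[|? ?] [y' [c' [//= _ Ey' Ec' Hs' HQ']]]].
  apply: (wp_arith0 Ey' Ec'); first by move: Hs'; rewrite max0n.
  by move: HQ' => /=; congr Q; st_eq.
- move=> a l s' E [[|b x'] [y' [c' [//= [-> ->] Ey' Ec' Hs' HQ']]]].
  rewrite wpE; have -> : (if ohead (sset s' rX (digs x') rY) is Some y then is1 y else false)
      = head false y'.
    by rewrite /sset /= Ey'; case: (y') => //= ? ?; rewrite is1_dgs.
  rewrite is1_dgs; apply: (wp_cellp (c := c')); rewrite /sset //=; first by lia.
  split=> //; exists x', (behead y'), (acar d b (head false y') c'); rewrite /sset /=.
  split=> //; rewrite ?size_behead ?Ey' -?behead_map //; first by lia.
  by move: HQ'; congr Q; st_eq.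
Qed.

Definition cmp : sprog :=
  Seq (arith true)
    (Seq (Loop rZ (fun x => if is1 x then setf rF else Skip _ _))
         (Case rC (fun o => if o is Some _ then setf rF else Skip _ _))).

Lemma wp_cmp x y Q s : s rX = digs x -> s rY = digs y -> s rC = [::] ->
  s rZ = [::] -> s rF = [::] -> maxn (size x) (size y) <= B ->
  Q (sset (sset (sset s rX [::]) rY [::]) rF (flag (bne x y))) ->
  wp cmp Q s.
Proof.
move=> Ex Ey Ec Ez Ef Hs HQ; rewrite /cmp !wpE.
apply: (wp_arith (c := false) Ex Ey) => //; first by rewrite Ez addn0.
rewrite /bne /blt in HQ; move: (ar true false x y) HQ => [z c] /= HQ.
set s1 := sset _ rZ _.
rewrite wpE; apply: (loopP (I := fun l s' => exists z f, [/\ l = digs z, s' rF = flag f,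
   s' rC = flag c &
   Q (sset (sset (sset s' rZ [::]) rC [::]) rF (flag (f || has id z || c)))])).
- exists (rev z), false; rewrite /s1 /sset Ez Ef catrevE cats0 map_rev has_rev; split=> //.
  by move: HQ; congr Q; st_eq.
- move=> s' E [[|? ?] [f [//= _ Ef' Ec']]]; rewrite orbF => HQ'; rewrite wpE Ec'.
  case: c {s1 HQ} Ec' HQ' => Ec' /=.
    rewrite orbT => HQ'; apply: (wp_setf (b := f)); rewrite /sset //.
    by move: HQ'; congr Q; st_eq.
  by rewrite orbF wpE; congr Q; st_eq.
- move=> a l s' E [[|b z'] [f [//= [-> ->] Ef' Ec' HQ']]]; rewrite is1_dgs.
  case: b HQ' {E} => HQ'.
    apply: (wp_setf (b := f)); rewrite /sset //; split=> //.
    exists z', true; rewrite /sset /=; split=> //.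
    by move: HQ'; rewrite /= !orbT; congr Q; st_eq.
  rewrite wpE; split=> //; exists z', f; rewrite /sset /=; split=> //.
  by move: HQ'; congr Q; st_eq.
Qed.

Definition addp : sprog :=
  Seq (arith false) (Case rC (fun o => Push rZ (dgs (isSome o)))).

Lemma wp_addp x y Q s : s rX = digs x -> s rY = digs y -> s rC = [::] ->
  s rZ = [::] -> maxn (size x) (size y) < B ->
  Q (sset (sset (sset s rX [::]) rY [::]) rZ (rev (digs (badd x y)))) ->
  wp addp Q s.
Proof.
move=> Ex Ey Ec Ez Hs HQ; rewrite /addp wpE.
apply: (wp_arith (c := false) Ex Ey) => //; first by rewrite Ez addn0 ltnW.
have := size_ar false false x y.
rewrite /badd in HQ; move: (ar false false x y) HQ => [z c] /= HQ Hz.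
rewrite !wpE /sset /= Ez catrevE cats0 size_rev size_map Hz; split=> //.
move: HQ; rewrite map_rcons rev_rcons; congr Q.
by st_eq; case: (c).
Qed.

Definition clean (s : state) : Prop :=
  map s [:: rX; rY; rZ; rC; rF; rT] = nseq 6 [::].

Lemma lstepE d y r q a z c : ar d false (d && a :: r) y = (z, c) ->
  let acc := if d then ~~ c else a in
  lstep d y (r, q) a =
  (if acc then (if d then z else rcons z c) else d && a :: r, acc :: q).
Proof. by move=> E; rewrite /lstep; cbv zeta; rewrite [(r, q).1]/= E. Qed.

(** Division subtracts on trial and discards the difference on a borrow; multiplication likewise
    forms the sum even for a zero bit and then drops it. The result lies reversed on [rZ], so one
    move puts it in order. *)
Definition lstepp (d a : bool) : sprog :=
  Seq (Push rR (dgs (d && a))) (Seq (copyp rR rX) (Seq (copyp rB rY)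
    (if d then Seq (arith true) (Case rC (fun o =>
         if o is Some _ then Seq (clearp rZ) (Push rQ E0)
         else Seq (clearp rR) (Seq (movep rZ rR) (Push rQ E1))))
     else Seq addp (Seq (if a then Seq (clearp rR) (movep rZ rR) else clearp rZ)
         (Push rQ (dgs a)))))).

Lemma wp_lstepp d a y st Q s : clean s ->
  s rR = digs st.1 -> s rQ = digs st.2 -> s rB = digs y ->
  (size st.1).+3 + size y <= B -> size st.2 < B ->
  Q (sset (sset s rR (digs (lstep d y st a).1)) rQ (digs (lstep d y st a).2)) ->
  wp (lstepp d a) Q s.
Proof.
case: st => r q [EX EY EZ EC EF ET] ER EQ EB Hr Hq HQ.
rewrite /= in ER EQ Hr Hq.
rewrite /lstepp wpE pushE ER size_map; split; first by lia.
rewrite seqE; apply: wp_copy => //; first by rewrite /sset /= EX size_map /=; lia.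
rewrite /sset /= EX cats0 seqE; apply: wp_copy => //.
  by rewrite /sset /= EB EY size_map /=; lia.
rewrite /sset /= EB EY cats0.
have Hs := size_ar d false (d && a :: r) y.
case Ez : (ar d false (d && a :: r) y) Hs => [z c] /= Hs.
rewrite (lstepE q Ez) in HQ; case: d Ez HQ Hs => Ez HQ Hs.
  rewrite seqE; apply: (wp_arith (c := false) (x := a :: r) (y := y)) => //.
    by rewrite /sset /= EZ /=; lia.
  rewrite Ez; set s1 := sset _ rZ _.
  have E1 : s1 rC = flag c by [].
  rewrite caseE E1; case: c {E1} @s1 Ez HQ => s1 Ez HQ; rewrite seqE /s1.
    apply: wp_clear => //; rewrite wpE /sset /= EQ size_map; split; first by lia.
    by move: HQ; congr Q; st_eq.
  apply: wp_clear => //; rewrite seqE; apply: wp_move => //.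
    by rewrite /sset /= EZ catrevE cats0 size_rev size_map Hs; lia.
  rewrite wpE /sset /= EQ size_map; split; first by lia.
  move: HQ; congr Q; st_eq => //.
  by rewrite EZ !catrevE !cats0 revK.
rewrite seqE; apply: (wp_addp (x := false :: r) (y := y)) => //; first by rewrite /=; lia.
have -> : badd (false :: r) y = rcons z c by rewrite /badd; cbv zeta; rewrite Ez.
rewrite seqE; case: a HQ Ez => HQ Ez.
  rewrite seqE; apply: wp_clear => //; apply: wp_move => //.
    by rewrite /sset /= size_rev size_map size_rcons Hs; lia.
  rewrite wpE /sset /= EQ size_map; split; first by lia.
  move: HQ; congr Q; st_eq => //.
  by rewrite !catrevE !cats0 revK.
apply: wp_clear => //; rewrite wpE /sset /= EQ size_map; split; first by lia.
by move: HQ; congr Q; st_eq.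
Qed.

Definition longp (d : bool) : sprog := Loop rA (fun x => lstepp d (is1 x)).

Lemma wp_longp d x y Q s : clean s -> s rR = [::] -> s rQ = [::] ->
  s rA = rev (digs x) -> s rB = digs y -> 2 * size x + 2 * size y + 5 <= B ->
  Q (sset (sset (sset s rA [::]) rR (digs (long d x y).1)) rQ (digs (long d x y).2)) ->
  wp (longp d) Q s.
Proof.
move=> Hc ER EQ EA EB Hs HQ.
(* Every bit still to come may lengthen the partial result by two, hence the term [2 * size u]. *)
apply: (loopP (I := fun l s => exists u st, [/\ l = digs u,
   clean s /\ s rB = digs y, s rR = digs st.1 /\ s rQ = digs st.2,
   maxn (size st.1) (size y) + 2 * size u + size y + 4 <= B /\ size st.2 + size u <= B &
   Q (sset (sset (sset s rA [::]) rR (digs (foldl (lstep d y) st u).1))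
           rQ (digs (foldl (lstep d y) st u).2))])).
- exists (rev x), ([::], [::]); rewrite EA map_rev ER EQ size_rev /=; split=> //; lia.
- move=> s' E [[|? ?] [st [//= _ _ [ER' EQ'] _ HQ']]].
  by move: HQ'; congr Q; st_eq.
- move=> a l s' E [[|b u] [st [//= [-> ->] [Hc' EB'] [ER' EQ'] [H1 H2] HQ']]].
  rewrite is1_dgs; apply: (wp_lstepp (st := st) (y := y)) => //; try by lia.
  split=> //; exists u, (lstep d y st b).
  have Hz : size (lstep d y st b).1 <= (maxn (size st.1).+1 (size y)).+1.
    case: (st) => r q; have := size_ar d false (d && b :: r) y.
    case Ez: (ar _ _ _ _) => [z c]; rewrite (lstepE q Ez) /= => Hz.
    by case: ifP; case: (d); rewrite /= ?size_rcons; lia.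
  split=> //; first by split; [lia | rewrite /lstep /=; lia].
  by move: HQ'; congr Q; st_eq.
Qed.

(** * Table lookup *)

(* The table is stored with all numbers most significant bit first, so that
   copying symbol by symbol onto a register puts the least significant bit on
   top. *)
Definition encv (o : option bits) : seq esym := if o is Some v then EIn :: digs v else [::].
(** The name lies on top, so it has been compared with the key before the value is reached. The
    [EIn] in [encv] marks a value as present, which separates it from the empty set whatever its
    digits. *)
Definition encent (nx : bits * option bits) : seq esym :=
  rev (digs nx.1) ++ ESep :: rev (encv nx.2) ++ [:: EGate].
Definition encenv (e : env) : seq esym := flatten (map encent e).

(** [rSEL] is empty while a name is read, [E1] while the value of the match is copied and [E0] while
    a value is skipped. *)
Definition valp (x : esym) (k : sprog) : sprog :=
  Case rSEL (fun o => match o with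
    | None => k
    | Some E1 => Seq (Push rSEL E1) (Push rRES x)
    | Some _ => Push rSEL E0
    end).

(** A loop cannot be left early: the whole table passes to [rENV2], and [rFND] keeps later entries
    from being selected after the first match. *)
Definition lkbody (x : esym) : sprog :=
  Seq (Push rENV2 x)
    match x with
    | E0 | E1 => valp x (Push rX x)
    | EIn => valp x (Skip _ _)
    | ESep =>
      Case rSEL (fun _ => Seq (copyp rKEY rY) (Seq cmp (Case rF (fun o =>
        if o is Some _ then Push rSEL E0
        else Case rFND (fun o => Seq (Push rFND E1)
               (Push rSEL (if o is Some _ then E0 else E1)))))))
    | EGate => Case rSEL (fun _ => Skip _ _)
    | _ => Skip _ _
    end.

Definition lookup : sprog :=
  Seq (Loop rENV lkbody) (movep rENV2 rENV).

(** A pure model of the registers of the lookup loop, which separates its meaning ([lkrun_env]) from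
    the bookkeeping on stacks ([wp_lkloop]). *)
Record lkst := Lk { lkx : bits; lksel : option bool; lkfnd : bool; lkres : seq esym }.

Definition lkdig (g : lkst) (x : esym) (b : option bool) : lkst :=
  let: Lk nx sel f res := g in
  match sel, b with
  | None, Some b => Lk (b :: nx) sel f res
  | Some true, _ => Lk nx sel f (x :: res)
  | _, _ => g
  end.

Definition lkstep (k : bits) (g : lkst) (x : esym) : lkst :=
  let: Lk nx sel f res := g in
  match x with
  | E0 => lkdig g x (Some false)
  | E1 => lkdig g x (Some true)
  | EIn => lkdig g x None
  | ESep => if bne nx k then Lk [::] (Some false) f res
            else Lk [::] (Some (~~ f)) true res
  | EGate => Lk nx None f res
  | _ => g
  end.

Definition lkrun k := foldl (lkstep k).

Lemma lkrun_name k f res n m :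
  lkrun k (Lk m None f res) (rev (digs n)) = Lk (n ++ m) None f res.
Proof.
rewrite /lkrun -map_rev -{2}[n]revK; elim: (rev n) m => [|b l IH] m //=.
by rewrite rev_cons cat_rcons -IH; case: b.
Qed.

Lemma lkrun_val k b f res v :
  lkrun k (Lk [::] (Some b) f res) (rev (encv v)) =
  Lk [::] (Some b) f (if b then encv v ++ res else res).
Proof.
rewrite /lkrun -{2}[encv v]revK.
have : all (fun x => match x with E0 | E1 | EIn => true | _ => false end) (rev (encv v)).
  by rewrite all_rev; case: v => [v|] //=; elim: v => [|[] v IH].
elim: (rev (encv v)) res => [|x l IH] res //=; first by case: b.
by case/andP=> Hx /IH{}IH; case: x Hx => //= _; case: b IH => IH;
  rewrite IH // rev_cons cat_rcons.
Qed.

Lemma lkrun_env k e f res :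
  lkrun k (Lk [::] None f res) (encenv e) =
  if f then Lk [::] None f res
  else Lk [::] None (isSome (lk e k)) (encv (odflt None (lk e k)) ++ res).
Proof.
have lkrun_cat g u v : lkrun k g (u ++ v) = lkrun k (lkrun k g u) v by apply: foldl_cat.
have lkrun_cons g x u : lkrun k g (x :: u) = lkrun k (lkstep k g x) u by [].
elim: e f res => [|[n v] e IH] f res; first by case: f.
have -> : encenv ((n, v) :: e) =
    rev (digs n) ++ ESep :: rev (encv v) ++ EGate :: encenv e.
  by rewrite /encenv /= /encent /= -!catA /= -catA.
rewrite lkrun_cat lkrun_name cats0 lkrun_cons /=.
case: (bne n k); rewrite lkrun_cat lkrun_val lkrun_cons /= IH //.
by case: f.
Qed.

Definition selr (o : option bool) : seq esym := if o is Some b then [:: dgs b] else [::].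

Lemma wp_lkloop k l g Q s : s rENV = l -> s rKEY = digs k ->
  s rX = digs (lkx g) -> s rSEL = selr (lksel g) -> s rFND = flag (lkfnd g) ->
  s rRES = lkres g -> [/\ s rY = [::], s rZ = [::], s rC = [::], s rF = [::] & s rT = [::]] ->
  size (s rENV2) + size l <= B -> size (lkx g) + size l + size k + 2 <= B ->
  size (lkres g) + size l <= B ->
  Q (sset (sset (sset (sset (sset (sset s rENV [::]) rENV2 (catrev l (s rENV2)))
     rX (digs (lkx (lkrun k g l)))) rSEL (selr (lksel (lkrun k g l))))
     rFND (flag (lkfnd (lkrun k g l)))) rRES (lkres (lkrun k g l))) ->
  wp (Loop rENV lkbody) Q s.
Proof.
move=> EL EK EX ES EFD ER Hc H1 H2 H3 HQ.
apply: (loopP (I := fun l s => exists g, [/\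
  s rKEY = digs k /\ s rX = digs (lkx g),
  [/\ s rSEL = selr (lksel g), s rFND = flag (lkfnd g) & s rRES = lkres g],
  [/\ s rY = [::], s rZ = [::], s rC = [::], s rF = [::] & s rT = [::]],
  [/\ size (s rENV2) + size l <= B, size (lkx g) + size l + size k + 2 <= B &
      size (lkres g) + size l <= B] &
  Q (sset (sset (sset (sset (sset (sset s rENV [::]) rENV2 (catrev l (s rENV2)))
     rX (digs (lkx (lkrun k g l)))) rSEL (selr (lksel (lkrun k g l))))
     rFND (flag (lkfnd (lkrun k g l)))) rRES (lkres (lkrun k g l)))])).
- by exists g; rewrite EL.
- move=> s' E [g' [[_ EX'] [ES' EF' ER'] _ _ HQ']].
  by move: HQ'; congr Q; st_eq.
move=> {g l EL EK EX ES EFD ER Hc H1 H2 H3 HQ s} x l s E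
  [g [[EK EX] [ES EFD ER] [EY EZ EC EF ET] [/= H1 H2 H3] HQ]].
rewrite /lkbody wpE pushE; split; first by rewrite /sset /=; lia.
set P := (X in wpre _ _ X _).
(* All branches finish through [close]: six registers are compared with the model, the others must
   be unchanged, and the sizes may grow by one per symbol consumed. *)
have close s' g' : s' rENV = l -> s' rENV2 = x :: s rENV2 ->
    s' rX = digs (lkx g') -> s' rSEL = selr (lksel g') -> s' rFND = flag (lkfnd g') ->
    s' rRES = lkres g' ->
    (forall r, reg_idx r \notin map reg_idx [:: rENV; rENV2; rX; rSEL; rFND; rRES] -> s' r = s r) ->
    size (lkx g') <= (size (lkx g)).+1 -> size (lkres g') <= (size (lkres g)).+1 ->
    g' = lkstep k g x ->
    P s'.
  move=> F1 F2 F3 F4 F5 F6 Fr L1 L2 Eg; split=> //; exists g'.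
  have Fr' r : (reg_idx r \in map reg_idx [:: rENV; rENV2; rX; rSEL; rFND; rRES]) = false ->
    s' r = s r by move/negbT/Fr.
  rewrite (Fr' rKEY erefl) (Fr' rY erefl) (Fr' rZ erefl) (Fr' rC erefl) (Fr' rF erefl)
    (Fr' rT erefl) F2; split=> //; first by split; rewrite /=; lia.
  by move: HQ; rewrite Eg; congr Q; st_eq; first [done | rewrite F2 // | rewrite Fr' //].
case: g close EX ES EFD ER H2 H3 {HQ} => nx sel f res /= close EX ES EFD ER H2 H3.
set s1 := sset (sset s rENV l) rENV2 _; have S1 : s1 rSEL = selr sel by [].
have S2 : s1 rRES = res by [].
have S3 : s1 rX = digs nx by [].
have S4 : s1 rKEY = digs k by [].
have S5 : s1 rY = [::] by [].
have S6 : s1 rFND = flag f by [].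
have vals k' : (forall b, lkstep k (Lk nx (Some b) f res) x =
    if b then Lk nx (Some b) f (x :: res) else Lk nx (Some b) f res) ->
  (sel = None -> wp k' P (sset s1 rSEL [::])) -> wp (valp x k') P s1.
  move=> Ey Hk; rewrite /valp caseE S1; case: sel {S1} ES close Hk => [b|] ES close Hk; last exact: Hk.
  have /= Hs : size (sset s1 rSEL [::] rSEL) < B by rewrite sset_eq /=; lia.
  case: b {Hk} ES close => ES close /=; rewrite wpE; rewrite ?pushE.
    split; first by [].
    split; first by rewrite /sset /= S2; lia.
    by apply: (close _ (Lk nx (Some true) f (x :: res))); rewrite //;
      first [by symmetry; apply: (Ey true) | by case | by rewrite /sset /= S2 | by rewrite /=; lia].
  split; first by [].
  by apply: (close _ (Lk nx (Some false) f res)); rewrite //;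
      first [by symmetry; apply: (Ey false) | by case | by rewrite /=; lia].
case: x E close @s1 S1 S2 S3 S4 S5 S6 vals {H1} => [|||||o] E close s1 S1 S2 S3 S4 S5 S6 vals.
- apply: vals => [[]|Es] //; rewrite pushE; split; first by rewrite /sset /= S3 size_map; lia.
  apply: (close _ (Lk (false :: nx) None f res)); rewrite ?Es //;
    first [by case | by rewrite /=; lia | by rewrite /sset /= S3].
- apply: vals => [[]|Es] //; rewrite pushE; split; first by rewrite /sset /= S3 size_map; lia.
  apply: (close _ (Lk (true :: nx) None f res)); rewrite ?Es //;
    first [by case | by rewrite /=; lia | by rewrite /sset /= S3].
- have Bs : behead (s1 rSEL) = [::] by rewrite S1; case: (sel).
  rewrite caseE Bs seqE; apply: wp_copy => //.
    by rewrite /sset /= S4 S5 size_map /=; lia.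
  rewrite seqE; apply: (wp_cmp (x := nx) (y := k)) => //.
  + by rewrite /sset /= S4 S5 cats0.
  + by lia.
  rewrite caseE; set s2 := sset _ rF _; have -> : s2 rF = flag (bne nx k) by [].
  rewrite /s2; case Eb: (bne nx k); rewrite [ohead _]/= [behead _]/=.
    rewrite pushE; split; first by rewrite /sset /=; lia.
    apply: (close _ (Lk [::] (Some false) f res)); rewrite ?Eb //;
      case; rewrite // /sset /= ?S5 ?EF //.
  rewrite caseE seqE pushE; split; first by rewrite /sset /= S6; case: (f) => /=; lia.
  rewrite pushE; split; first by rewrite /sset /=; lia.
  apply: (close _ (Lk [::] (Some (~~ f)) true res)); rewrite ?Eb //.
  + by rewrite /sset /= S6; case: (f).
  + by rewrite /sset /= S6; case: (f).
  + by case; rewrite // /sset /= ?S5 ?EF.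
- have Bs : behead (s1 rSEL) = [::] by rewrite S1; case: (sel).
  rewrite caseE Bs skipE; apply: (close _ (Lk nx None f res)); rewrite //;
    first [by case | by rewrite /=; lia].
- apply: vals => [[]|Es] //; rewrite skipE; apply: (close _ (Lk nx None f res));
    rewrite ?Es //; first [by case | by rewrite /=; lia].
- by rewrite skipE; apply: (close _ (Lk nx sel f res)); rewrite //;
    first [by case | by rewrite /=; lia].
Qed.

Lemma wp_copy0 i j u Q s : i <> j -> i <> rT -> j <> rT -> s rT = [::] ->
  s i = u -> s j = [::] -> size u <= B -> Q (sset s j u) -> wp (copyp i j) Q s.
Proof. by move=> ij iT jT ET Ei Ej Hs HQ; apply: wp_copy; rewrite // Ei Ej ?addn0 ?cats0. Qed.

Lemma wp_mv20 i j u Q s : i <> j -> i <> rT -> j <> rT -> s rT = [::] ->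
  s i = u -> s j = [::] -> size u <= B -> Q (sset (sset s i [::]) j u) ->
  wp (mvp i j) Q s.
Proof. by move=> ij iT jT ET Ei Ej Hs HQ; apply: wp_mv2; rewrite // Ei Ej ?addn0 ?cats0. Qed.

Lemma wp_move0 i j u v Q s : i <> j -> s i = u -> s j = v ->
  size u + size v <= B -> Q (sset (sset s i [::]) j (rev u ++ v)) -> wp (movep i j) Q s.
Proof. by move=> ij Ei Ej Hs HQ; apply: wp_move; rewrite // Ei Ej // catrevE. Qed.

Definition lkclean (s : state) : Prop :=
  map s [:: rSEL; rENV2; rFND; rRES] = nseq 4 [::].

Lemma wp_lookup k e Q s : clean s -> lkclean s -> s rKEY = digs k ->
  s rENV = encenv e -> size (encenv e) + size k + 2 <= B ->
  Q (sset (sset s rFND (flag (isSome (lk e k)))) rRES (encv (odflt None (lk e k)))) ->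
  wp lookup Q s.
Proof.
move=> [EX EY EZ EC EF ET] [ES EE2 EFD ER] EK EE Hs HQ; rewrite /lookup seqE.
apply: (wp_lkloop (k := k) (g := Lk [::] None false [::])) => //=.
- by rewrite EE EE2 /=; lia.
- by rewrite EE; lia.
- by rewrite EE; lia.
apply: (wp_move0 (u := rev (encenv e)) (v := [::])) => //.
- by rewrite /sset /= EE2 EE catrevE cats0.
- by rewrite size_rev addn0; lia.
move: HQ; rewrite EE lkrun_env /= !cats0 revK; congr Q.
by st_eq.
Qed.

(** * Rejection, canonicity test and gate operations *)

Definition failp : sprog := Push rBAD E1.

(* Once [rBAD] is set the input is rejected, whatever the other registers
   contain. *)
Definition okfail (Q : state -> Prop) (inp : seq esym) : Prop :=
  forall s', s' rBAD = [:: E1] -> s' rIN = inp -> Q s'.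

Lemma wp_fail Q s : s rBAD = [::] -> okfail Q (s rIN) -> wp failp Q s.
Proof.
move=> Eb H; rewrite pushE Eb; split; first by rewrite /=; lia.
exact: H.
Qed.

(** Since the text is read leftwards, the most significant bit is on top of [rBUF]. At most two pops
    decide canonicity, and one reversing move brings the least significant bit to the top. *)
Definition ckmove (tgt : reg) (k : sprog) : sprog :=
  Seq (clearp tgt) (Case rBUF (fun o =>
    match o with
    | Some E1 => Seq (Push rBUF E1) (Seq (movep rBUF tgt) k)
    | Some E0 => Case rBUF (fun o => if o is Some _ then failp else Seq (Push tgt E0) k)
    | _ => failp
    end)).

Lemma wp_ckmove tgt k bf (Q : state -> Prop) s : tgt <> rBUF -> tgt <> rBAD -> tgt <> rIN ->
  s rBUF = digs bf -> s rBAD = [::] -> size bf <= B ->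
  (if canon bf then wp k Q (sset (sset s rBUF [::]) tgt (digs (rev bf)))
   else okfail Q (s rIN)) ->
  wp (ckmove tgt k) Q s.
Proof.
move=> Hb Hd Hi EB ED Hs HQ; rewrite /ckmove seqE; apply: wp_clear.
have Bd : rBUF <> rBAD by []. have Bi : rBUF <> rIN by [].
have Hb' : rBUF <> tgt by congruence.
have N1 := fun s v => @sset_ne s _ _ v Hb. have N2 := fun s v => @sset_ne s _ _ v Hb'.
have N3 := fun s v => @sset_ne s _ _ v Hd. have N4 := fun s v => @sset_ne s _ _ v Hi.
have N5 := fun s v => @sset_ne s _ _ v Bd. have N6 := fun s v => @sset_ne s _ _ v Bi.
rewrite caseE (sset_ne _ _ Hb) EB.
case: bf EB Hs HQ => [|[] bf] EB Hs HQ; rewrite [ohead _]/= [behead _]/=.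
- by apply: wp_fail; rewrite !(N1, N2, N3, N4, N5, N6, sset_eq).
- rewrite seqE pushE !(N1, N2, N3, N4, N5, N6, sset_eq) size_map; split=> //.
  rewrite seqE; apply: (wp_move0 (u := E1 :: digs bf) (v := [::])) => //.
  + by rewrite !(N1, N2, N3, N4, N5, N6, sset_eq).
  + by rewrite addn0 /= size_map.
  move: HQ; rewrite /canon /= cats0 [digs (rev _)]map_rev; congr wpre.
  by gst_eq.
- rewrite caseE !(N1, N2, N3, N4, N5, N6, sset_eq); case: bf EB Hs HQ => [|b bf] EB Hs HQ;
    rewrite [ohead _]/= [behead _]/=.
    rewrite seqE pushE !(N1, N2, N3, N4, N5, N6, sset_eq); split; first by rewrite /=; lia.
    move: HQ; rewrite /canon /=; congr wpre.
    by gst_eq.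
  by apply: wp_fail; rewrite !(N1, N2, N3, N4, N5, N6, sset_eq).
Qed.

Definition setv (i : reg) : sprog := Seq (mvp i rV) (Push rV EIn).

Lemma wp_setv i v Q s : i <> rV -> i <> rT -> s rT = [::] -> s rV = [::] ->
  s i = digs v -> size v < B -> Q (sset (sset s i [::]) rV (encv (Some v))) ->
  wp (setv i) Q s.
Proof.
move=> iV iT ET EV Ei Hs HQ; rewrite /setv seqE.
apply: (wp_mv20 (u := digs v)) => //; first by rewrite size_map ltnW.
rewrite pushE sset_eq size_map; split=> //.
by move: HQ; congr Q; gst_eq.
Qed.

Definition compp (o : op) : sprog :=
  Case rU (fun o1 => Case rRES (fun o2 =>
    match o1, o2 with
    | Some _, Some _ =>
      match o with
      | OPlus => Seq (mvp rU rX) (Seq (mvp rRES rY) (Seq addp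
                   (Seq (movep rZ rR) (setv rR))))
      | OCap => Seq (copyp rU rX) (Seq (mvp rRES rY) (Seq cmp (Case rF (fun f =>
                   if f is Some _ then clearp rU else setv rU))))
      | OTimes => Seq (movep rU rA) (Seq (mvp rRES rB) (Seq (longp false)
                   (Seq (clearp rQ) (Seq (clearp rB) (setv rR)))))
      | ODiv => Seq (movep rU rA) (Seq (mvp rRES rB) (Seq (copyp rB rX) (Seq cmp
                   (Case rF (fun f => if f is Some _ then
                     Seq (longp true) (Seq (clearp rB) (Seq (mvp rR rX) (Seq cmp
                       (Case rF (fun f => if f is Some _ then clearp rQ else setv rQ)))))
                     else Seq (clearp rA) (clearp rB))))))
      | _ => Skip _ _
      end
    | _, _ => Seq (clearp rU) (clearp rRES)
    end)).

Definition opclean (s : state) : Prop :=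
  map s [:: rA; rB; rR; rQ; rV] = nseq 5 [::].

(** The bound [4 * V + 6] comes from [wp_longp], which needs [2 * size x + 2 * size y + 5]. *)
Lemma wp_compp tm o u r V Q s : alw tm o -> clean s -> opclean s ->
  s rU = encv u -> s rRES = encv r ->
  size (odflt [::] u) <= V -> size (odflt [::] r) <= V -> 4 * V + 6 <= B ->
  Q (sset (sset (sset s rU [::]) rRES [::]) rV (encv (opv o u r))) ->
  wp (compp o) Q s.
Proof.
move=> Ho Hc Hoc EU ER Hu Hr HB HQ.
have [EX EY EZ EC EF ET] := Hc; have [EA EB ER' EQ EV] := Hoc.
rewrite /compp caseE caseE EU.
case: u EU Hu HQ => [u|] EU Hu HQ; last first.
  rewrite [ohead _]/= [behead _]/= seqE; apply: wp_clear; apply: wp_clear.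
  by move: HQ; congr Q; st_eq.
have -> : sset s rU (behead (encv (Some u))) rRES = encv r by rewrite -ER.
case: r ER Hr HQ => [r|] ER Hr HQ; last first.
  rewrite [ohead _]/= [behead _]/= seqE; apply: wp_clear; apply: wp_clear.
  by move: HQ; congr Q; st_eq.
rewrite [ohead _]/= [behead _]/= [ohead _]/= [behead _]/=.
rewrite [odflt _ _]/= in Hu; rewrite [odflt _ _]/= in Hr.
set s1 := sset _ rRES _.
have D1 : s1 rU = digs u by []. have D2 : s1 rRES = digs r by [].
case: o Ho HQ => //= _ HQ.
- rewrite seqE; apply: (wp_copy0 (u := digs u)) => //; first by rewrite size_map; lia.
  rewrite seqE; apply: (wp_mv20 (u := digs r)) => //; first by rewrite size_map; lia.
  rewrite seqE; apply: (wp_cmp (x := u) (y := r)) => //; first by lia.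
  rewrite caseE sset_eq; case: (bne u r) HQ => HQ; rewrite [ohead _]/= [behead _]/=.
    by apply: wp_clear; move: HQ; congr Q; st_eq.
  apply: (wp_setv (v := u)) => //; first by lia.
  by move: HQ; congr Q; st_eq.
- rewrite seqE; apply: (wp_mv20 (u := digs u)) => //; first by rewrite size_map; lia.
  rewrite seqE; apply: (wp_mv20 (u := digs r)) => //; first by rewrite size_map; lia.
  rewrite seqE; apply: (wp_addp (x := u) (y := r)) => //; first by lia.
  rewrite seqE; apply: (wp_move0 (u := rev (digs (badd u r))) (v := [::])) => //.
    by rewrite size_rev size_map size_badd addn0; lia.
  apply: (wp_setv (v := badd u r)) => //.
  + by rewrite sset_eq cats0 revK.
  + by rewrite size_badd; lia.
  by move: HQ; congr Q; st_eq.
- rewrite seqE; apply: (wp_move0 (u := digs u) (v := [::])) => //.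
    by rewrite size_map addn0; lia.
  rewrite seqE; apply: (wp_mv20 (u := digs r)) => //; first by rewrite size_map; lia.
  have Hm := size_mul u r.
  rewrite seqE; apply: (wp_longp (x := u) (y := r)) => //; try by lia.
    by rewrite /sset /= cats0.
  rewrite seqE; apply: wp_clear; rewrite seqE; apply: wp_clear.
  apply: (wp_setv (v := (long false u r).1)) => //; first by lia.
  by move: HQ; congr Q; st_eq.
- rewrite seqE; apply: (wp_move0 (u := digs u) (v := [::])) => //.
    by rewrite size_map addn0; lia.
  rewrite seqE; apply: (wp_mv20 (u := digs r)) => //; first by rewrite size_map; lia.
  rewrite seqE; apply: (wp_copy0 (u := digs r)) => //; first by rewrite size_map; lia.
  rewrite seqE; apply: (wp_cmp (x := r) (y := [::])) => //; first by rewrite maxn0; lia.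
  rewrite caseE sset_eq; case: (bne r [::]) HQ => HQ; rewrite [ohead _]/= [behead _]/=;
    last first.
    rewrite seqE; apply: wp_clear; apply: wp_clear.
    by move: HQ; congr Q; st_eq.
  have Hm := size_rem u r; have Hm2 := size_long2 true u r.
  rewrite seqE; apply: (wp_longp (x := u) (y := r)) => //; try by lia.
  - by rewrite /clean /s1 /sset /= EZ EC ET.
  - by rewrite /sset /= cats0.
  rewrite seqE; apply: wp_clear.
  rewrite seqE; apply: (wp_mv20 (u := digs (long true u r).1)) => //.
    by rewrite size_map; lia.
  rewrite seqE; apply: (wp_cmp (x := (long true u r).1) (y := [::])) => //.
    by rewrite maxn0; lia.
  rewrite caseE sset_eq; case: (bne (long true u r).1 [::]) HQ => HQ;
    rewrite [ohead _]/= [behead _]/=.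
    by apply: wp_clear; move: HQ; congr Q; st_eq.
  apply: (wp_setv (v := (long true u r).2)) => //; first by lia.
  by move: HQ; congr Q; st_eq.
Qed.

(** * Completing a gate *)

Definition getp (i : reg) (k : sprog) : sprog :=
  Seq (copyp i rKEY) (Seq lookup (Seq (clearp rKEY) k)).

Lemma wp_getp i key e k Q s : i <> rKEY -> i <> rT -> clean s -> lkclean s ->
  s rKEY = [::] -> s i = digs key -> s rENV = encenv e ->
  size (encenv e) + size key + 2 <= B ->
  wp k Q (sset (sset s rFND (flag (isSome (lk e key)))) rRES
            (encv (odflt None (lk e key)))) ->
  wp (getp i k) Q s.
Proof.
move=> iK iT Hc Hl EK Ei EE Hs HQ; have [_ _ _ _ _ ET] := Hc.
rewrite /getp seqE; apply: (wp_copy0 (u := digs key)) => //.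
  by rewrite size_map; lia.
rewrite seqE; apply: (wp_lookup (k := key) (e := e)) => //.
rewrite seqE; apply: wp_clear.
by move: HQ; congr wpre; st_eq.
Qed.

Definition storep (k : sprog) : sprog :=
  Seq (Push rENV EGate) (Seq (movep rV rENV) (Seq (Push rENV ESep)
    (Seq (movep rNM rENV) k))).

Lemma wp_storep nm v en k Q s : s rV = encv v -> s rNM = digs nm ->
  s rENV = encenv en -> size (encenv en) + size (encv v) + size nm + 2 <= B ->
  wp k Q (sset (sset (sset s rV [::]) rNM [::]) rENV (encenv ((nm, v) :: en))) ->
  wp (storep k) Q s.
Proof.
move=> EV EN EE Hs HQ; rewrite /storep seqE pushE EE; split; first by lia.
rewrite seqE; apply: (wp_move0 (u := encv v) (v := EGate :: encenv en)) => //.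
  by rewrite /=; lia.
rewrite seqE pushE sset_eq; split.
  by rewrite size_cat size_rev /=; lia.
rewrite seqE; apply: (wp_move0 (u := digs nm)
  (v := ESep :: rev (encv v) ++ EGate :: encenv en)) => //.
  by rewrite /= size_cat size_rev size_map /=; lia.
have <- : encenv ((nm, v) :: en) =
    rev (digs nm) ++ ESep :: rev (encv v) ++ EGate :: encenv en.
  by rewrite /encenv /= /encent /= -!catA /= -catA.
by move: HQ; congr wpre; st_eq.
Qed.

Definition swapp : sprog := Seq (mvp rPR rU) (Seq (mvp rQR rPR) (mvp rU rQR)).

(** Mirrors [fin]. The predecessors are ordered by a trial subtraction: no borrow means that the
    first is not smaller, and they are swapped. *)
Definition finp (k : sprog) : sprog :=
  getp rNM (Case rFND (fun f => if f is Some _ then failp else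
    Case rLAB (fun l =>
      match l with
      | Some EIn => Seq (setv rQR) (Seq (clearp rPR) (storep k))
      | Some (EOp o) =>
        Seq (copyp rPR rX) (Seq (copyp rQR rY) (Seq (arith true) (Seq (clearp rZ)
          (Case rC (fun c => Seq (if c is Some _ then Skip _ _ else swapp)
             (getp rPR (Case rFND (fun f =>
               if f is Some _ then
                 Seq (mvp rRES rU) (getp rQR
                   (Case rFND (fun f => if f is Some _ then
                     Seq (compp o) (Seq (clearp rPR) (Seq (clearp rQR) (storep k)))
                     else failp)))
               else failp))))))))
      | _ => failp
      end))).

Lemma wp_finp tm k lb nm p q en n V (Q : state -> Prop) s : lbok tm lb ->
  clean s -> opclean s -> lkclean s -> s rKEY = [::] -> s rU = [::] ->
  s rBAD = [::] -> s rNM = digs nm -> s rLAB = lb -> s rPR = digs p ->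
  s rQR = digs q -> s rENV = encenv en -> envok n V en ->
  size nm <= n -> size p <= n -> size q <= n -> n <= V ->
  size (encenv en) + 4 * V + n + 8 <= B ->
  match fin lb nm p q en return Prop with
  | Some e => wp k Q (sset (sset (sset (sset (sset s rNM [::]) rLAB [::])
                 rPR [::]) rQR [::]) rENV (encenv e))
  | None => okfail Q (s rIN)
  end ->
  wp (finp k) Q s.
Proof.
move=> Hlb Hc Hoc Hlc EK EU EBD EN EL EP EQ EE He Hn Hp Hq HnV HB HQ.
have [EX EY EZ EC EF ET] := Hc; have [EA EB' ER EQ' EV] := Hoc.
have [ES EE2 EFD ERS] := Hlc.
rewrite /finp; apply: (wp_getp (key := nm) (e := en)) => //; first by lia.
rewrite /fin in HQ; rewrite caseE [X in ohead X]/sset /=.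
case: (lk en nm) HQ => [v|] HQ.
  by rewrite [ohead _]/= [behead _]/=; apply: wp_fail.
rewrite [ohead _]/= [behead _]/= caseE.
set s1 := sset _ rFND _; have E1 : s1 rLAB = lb by []; rewrite E1.
have {E1}Es1 : s1 = s by apply: functional_extensionality; case; rewrite // /s1 /sset /= ?EFD ?ERS.
rewrite {}Es1.
case: lb EL Hlb HQ => [|x [|y lb]] EL Hlb HQ; first by apply: wp_fail.
  2: by case: x Hlb EL HQ.
rewrite [ohead _]/= [behead _]/=.
case: x EL Hlb HQ => [|||||o] // EL Hlb HQ.
  rewrite seqE; apply: (wp_setv (v := q)) => //; first by lia.
  rewrite seqE; apply: wp_clear.
  apply: (wp_storep (nm := nm) (v := Some q) (en := en)) => //.
    by rewrite /= size_map; lia.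
  by move: HQ; congr wpre; st_eq.
rewrite seqE; apply: (wp_copy0 (u := digs p)) => //; first by rewrite size_map; lia.
rewrite seqE; apply: (wp_copy0 (u := digs q)) => //; first by rewrite size_map; lia.
rewrite seqE; apply: (wp_arith (c := false) (x := p) (y := q)) => //.
  by rewrite /sset /= EZ /=; lia.
rewrite seqE; apply: wp_clear.
rewrite caseE; set c0 := (X in ohead X); have -> : c0 = flag (blt p q) by [].
rewrite {}/c0; set s3 := (X in wpre _ _ _ X).
have -> : s3 = sset s rLAB [::].
  by rewrite /s3; st_eq; rewrite ?EX ?EY ?EZ ?EC //; case: (ar true false p q).2.
rewrite {s3} seqE; set k1 := if blt p q then p else q; set k2 := if blt p q then q else p.
(* Both outcomes of the comparison lead to this state, so the remainder is verified once for the
   ordered keys. *)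
suff H0 : wp (getp rPR (Case rFND (fun f =>
               if f is Some _ then
                 Seq (mvp rRES rU) (getp rQR
                   (Case rFND (fun f => if f is Some _ then
                     Seq (compp o) (Seq (clearp rPR) (Seq (clearp rQR) (storep k)))
                     else failp)))
               else failp))) Q
     (sset (sset (sset s rLAB [::]) rPR (digs k1)) rQR (digs k2)).
  move: H0; rewrite {HQ}/k1 /k2; case: (blt p q) => HQ; rewrite [ohead _]/=.
    by rewrite skipE; move: HQ; congr wpre; st_eq.
  rewrite /swapp seqE; apply: (wp_mv20 (u := digs p)) => //; first by rewrite size_map; lia.
  rewrite seqE; apply: (wp_mv20 (u := digs q)) => //; first by rewrite size_map; lia.
  apply: (wp_mv20 (u := digs p)) => //; first by rewrite size_map; lia.
  by move: HQ; congr wpre; st_eq.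
rewrite -/k1 -/k2 in HQ.
have Hk1 : size k1 <= n by rewrite /k1; case: ifP.
have Hk2 : size k2 <= n by rewrite /k2; case: ifP.
apply: (wp_getp (key := k1) (e := en)) => //; first by lia.
rewrite caseE; set c0 := (X in ohead X).
have -> : c0 = flag (isSome (lk en k1)) by [].
rewrite {}/c0; case L1: (lk en k1) HQ => [u|] HQ; rewrite [ohead _]/=; last by apply: wp_fail.
have Hu := lk_envok He L1.
have Hu' : size (encv u) <= V.+1 by case: (u) Hu => //= v; rewrite size_map; lia.
rewrite seqE; apply: (wp_mv20 (u := encv u)) => //; first by lia.
set s4 := (X in wpre _ _ _ X).
have -> : s4 = sset (sset (sset (sset s rLAB [::]) rPR (digs k1)) rQR (digs k2)) rU (encv u).
  by rewrite /s4; st_eq; rewrite ?ERS ?EFD.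
rewrite {s4}.
apply: (wp_getp (key := k2) (e := en)) => //; first by lia.
rewrite caseE; set c0 := (X in ohead X).
have -> : c0 = flag (isSome (lk en k2)) by [].
rewrite {}/c0; case L2: (lk en k2) HQ => [r|] HQ; rewrite [ohead _]/=; last by apply: wp_fail.
have Hr := lk_envok He L2.
set s5 := (X in wpre _ _ _ X).
have -> : s5 = sset (sset (sset (sset (sset s rLAB [::]) rPR (digs k1)) rQR (digs k2))
    rU (encv u)) rRES (encv r).
  by rewrite /s5; st_eq; rewrite ?EFD.
rewrite {s5} seqE; apply: (wp_compp (u := u) (r := r) (V := V) Hlb) => //; first by lia.
rewrite seqE; apply: wp_clear; rewrite seqE; apply: wp_clear.
apply: (wp_storep (nm := nm) (v := opv o u r) (en := en)) => //.
  have := size_opv Hlb (leqnn _) Hu Hr; case: (opv o u r) => [v|] /=; rewrite ?size_map;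
  case: (tm); lia.
by move: HQ; congr wpre; st_eq.
Qed.

(** * The main loop *)

(** The start mode [Mb] is represented by an empty [rMODE], so the initial tape, with only [rIN]
    filled, already represents [st0]. *)
Definition msym (m : mode) : esym :=
  match m with
  | Mb | Mg => E0 | Mq => E1 | Mp => ESep | Mo => EGate | Ms => EIn
  | Mn => EOp OCup | Mout => EOp OCap
  end.
Definition symm (o : option esym) : mode :=
  match o with
  | None => Mb
  | Some E0 => Mg | Some E1 => Mq | Some ESep => Mp | Some EGate => Mo
  | Some EIn => Ms | Some (EOp OCup) => Mn | Some (EOp _) => Mout
  end.
Definition mreg (m : mode) : seq esym := if m is Mb then [::] else [:: msym m].

Lemma mregK m : symm (ohead (mreg m)) = m.
Proof. by case: m. Qed.

Lemma behead_mreg m : behead (mreg m) = [::].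
Proof. by case: m. Qed.

Definition regs (inp : seq esym) (t4 : bits) (st : st) : state := fun r =>
  match r with
  | rIN => inp | rT4 => digs t4 | rMODE => mreg (md st) | rBUF => digs (bf st)
  | rLAB => lb st | rPR => digs (pr st) | rQR => digs (qr st) | rBV => digs (bv st)
  | rENV => encenv (en st) | _ => [::]
  end.

Definition setm (m : mode) : sprog := if m is Mb then Skip _ _ else Push rMODE (msym m).

Arguments setm : simpl never.

Lemma wp_setm m Q s : s rMODE = [::] -> Q (sset s rMODE (mreg m)) -> wp (setm m) Q s.
Proof.
move=> E HQ; case: m HQ => HQ; rewrite /setm ?pushE ?skipE ?E //;
  try (by split; [rewrite /=; lia | exact: HQ]).
by move: HQ; congr Q; rewrite /= -{1}E sset_id.
Qed.

Definition putp (m : mode) (x : esym) : sprog :=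
  if isdig m then Seq (Push rBUF x) (setm m) else failp.

Definition setlab (x : esym) : sprog :=
  Seq (clearp rLAB) (Seq (Push rLAB x) (setm Ms)).

Definition mainp (tm : bool) (x : esym) : sprog :=
  Case rMODE (fun o =>
    match x, symm o with
    | E0, m => putp m E0
    | E1, m => putp m E1
    | ESep, Mb => ckmove rBV (setm Mg)
    | ESep, Mg => setm Mout
    | ESep, Mq => ckmove rQR (setm Mp)
    | ESep, Mp => ckmove rPR (setm Mo)
    | ESep, Ms => setm Mn
    | ESep, Mn => ckmove rNM (finp (setm Mout))
    | EGate, Mg => setm Mq
    | EGate, Mn => ckmove rNM (finp (setm Mq))
    | EIn, Mq => ckmove rQR (setlab EIn)
    | EOp o, Mo => if alw tm o then setlab (EOp o) else failp
    | _, _ => failp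
    end).

Definition szok (tm : bool) (n V : nat) (s : st) : Prop :=
  [/\ lbok tm (lb s), envok n V (en s), size (bf s) <= n,
       size (pr s) <= n /\ size (qr s) <= n &
       n <= V /\ size (encenv (en s)) + 4 * V + n + 8 <= B].

Lemma wp_close tm n V inp t4 m st' (Q : state -> Prop) : szok tm n V st' -> md st' = Mn ->
  match close m st' return Prop with Some s => Q (regs inp t4 s) | None => okfail Q inp end ->
  wp (ckmove rNM (finp (setm m))) Q (sset (regs inp t4 st') rMODE [::]).
Proof.
case: st' => m' bf lb pr qr bv en [/= Hlb He Hbf [Hpr Hqr] [HnV HB]] _ HQ.
apply: (wp_ckmove (bf := bf)) => //; first by lia.
rewrite /close /= in HQ; case: (canon bf) HQ => // HQ.
apply: (wp_finp (nm := rev bf) (p := pr) (q := qr) (en := en) Hlb _ _ _ _ _ _ _ _ _ _ _ He) => //.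
  by rewrite size_rev.
case: fin HQ => [e|] // HQ; apply: wp_setm => //.
by move: HQ; rewrite /=; congr Q; st_eq.
Qed.

Lemma wp_mainp tm n V inp t4 st x (Q : state -> Prop) : szok tm n V st ->
  match step1 tm st x return Prop with Some s => Q (regs inp t4 s) | None => okfail Q inp end ->
  wp (mainp tm x) Q (regs inp t4 st).
Proof.
move=> Hs HQ; rewrite /mainp caseE.
have -> : regs inp t4 st rMODE = mreg (md st) by [].
rewrite mregK behead_mreg.
case: st Hs HQ => m bf lb pr qr bv en Hs HQ; rewrite [md _]/=.
have [Hlb He Hbf _ [HnV HB]] := Hs; rewrite /= in Hbf HB.
set s0 := sset _ rMODE _.
have BF : okfail Q inp -> wp failp Q s0 by move=> HF; apply: wp_fail.
have PD b : match putdig b (St m bf lb pr qr bv en) return Prop with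
              Some s => Q (regs inp t4 s) | None => okfail Q inp end ->
    wp (putp m (dgs b)) Q s0.
  rewrite /putp /putdig [md _]/=; case: isdig => // {}HQ; rewrite seqE pushE.
  split; first by rewrite /s0 /sset /= size_map; lia.
  by apply: wp_setm => //; move: HQ; congr Q; st_eq.
have SM m' : Q (sset s0 rMODE (mreg m')) -> wp (setm m') Q s0 by apply: wp_setm.
have CK tgt k : tgt <> rBUF -> tgt <> rBAD -> tgt <> rIN ->
    (if canon bf then wp k Q (sset (sset s0 rBUF [::]) tgt (digs (rev bf)))
     else okfail Q inp) -> wp (ckmove tgt k) Q s0.
  by move=> h1 h2 h3 h4; apply: (wp_ckmove (bf := bf)) => //; lia.
have SL x' s : s rMODE = [::] -> Q (sset (sset s rLAB [:: x']) rMODE (mreg Ms)) ->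
    wp (setlab x') Q s.
  move=> EM h; rewrite /setlab seqE; apply: wp_clear; rewrite seqE pushE sset_eq.
  split; first by rewrite /=; lia.
  by apply: wp_setm => //; move: h; congr Q; st_eq.
case: x {Hlb He} HQ => [|||||o] HQ.
- exact: (PD false).
- exact: (PD true).
- case: m Hs HQ @s0 BF PD SM CK => Hs HQ s0 BF _ SM CK; try exact: BF.
  + apply: CK => //; move: HQ; rewrite /=; case: canon => // HQ.
    by apply: wp_setm => //; move: HQ; congr Q; st_eq.
  + by apply: SM; move: HQ; congr Q; st_eq.
  + apply: CK => //; move: HQ; rewrite /=; case: canon => // HQ.
    by apply: wp_setm => //; move: HQ; congr Q; st_eq.
  + apply: CK => //; move: HQ; rewrite /=; case: canon => // HQ.
    by apply: wp_setm => //; move: HQ; congr Q; st_eq.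
  + by apply: SM; move: HQ; congr Q; st_eq.
  + exact: (wp_close Hs).
- case: m Hs HQ @s0 BF PD SM CK => Hs HQ s0 BF _ SM CK; try exact: BF.
  + by apply: SM; move: HQ; congr Q; st_eq.
  + exact: (wp_close Hs).
- case: m Hs HQ @s0 BF PD SM CK => Hs HQ s0 BF _ SM CK; try exact: BF.
  apply: CK => //; move: HQ; rewrite /=; case: canon => // HQ.
  by apply: SL => //; move: HQ; congr Q; st_eq.
- case: m Hs HQ @s0 BF PD SM CK => Hs HQ s0 BF _ SM CK; try exact: BF.
  move: HQ; rewrite /=; case: (alw tm o) => // HQ.
  by apply: SL => //; move: HQ; congr Q; st_eq.
Qed.

Definition bitp (tm : bool) (a : esym) : sprog :=
  Case rT4 (fun o1 => Case rT4 (fun o2 => Case rT4 (fun o3 =>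
    match o1, o2, o3 with
    | Some b, Some c, Some d =>
      if dec4 (is1 a) (is1 b) (is1 c) (is1 d) is Some x then mainp tm x else failp
    | Some b, Some c, None => Seq (Push rT4 c) (Seq (Push rT4 b) (Push rT4 a))
    | Some b, None, _ => Seq (Push rT4 b) (Push rT4 a)
    | None, _, _ => Push rT4 a
    end))).

Lemma wp_bitp tm n V inp t4 st a (Q : state -> Prop) : size t4 < 4 -> szok tm n V st ->
  match stepb tm (t4, st) a return Prop with
  | Some ts => Q (regs inp ts.1 ts.2)
  | None => okfail Q inp
  end ->
  wp (bitp tm (dgs a)) Q (regs inp t4 st).
Proof.
move=> H4 Hs HQ; rewrite /bitp !caseE /stepb in HQ *.
case: t4 H4 HQ => [|b [|c [|d [|e t4]]]] // _ HQ;
  rewrite /sset /= ?pushE ?seqE ?pushE /=.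
- by split; [lia | move: HQ; congr Q; st_eq].
- by split; [lia | split; [lia | move: HQ; congr Q; st_eq]].
- split; [lia | rewrite seqE pushE /sset /=].
  split; [lia | rewrite pushE /sset /=].
  by split; [lia | move: HQ; congr Q; st_eq].
rewrite /= !is1_dgs in HQ *; case: dec4 HQ => [x|] HQ.
  have {}HQ : match step1 tm st x return Prop with
      Some s => Q (regs inp [::] s) | None => okfail Q inp end.
    by case: step1 HQ.
  by have := wp_mainp Hs HQ; congr wpre; st_eq.
by apply: wp_fail.
Qed.

(** After a failure the flag is put back in each round and the rest of the input is merely
    drained. *)
Definition loopp (tm : bool) : sprog :=
  Loop rIN (fun a => Case rBAD (fun o => if o is Some _ then Push rBAD E1 else bitp tm a)).

Definition runb (tm : bool) : option (bits * st) -> bits -> option (bits * st) :=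
  foldl (fun o a => obind (stepb tm ^~ a) o).

Lemma runb_rev tm w : runb tm (Some ([::], st0)) (rev w) = parseb tm w.
Proof. by rewrite /runb foldl_rev. Qed.

(** The registers follow the parser while it succeeds; afterwards only [rBAD] and the remaining
    input are tracked. Size bounds are assumed for each prefix read, to be supplied by
    [runb_stok]. *)
Lemma wp_loopp tm n V w (Q : state -> Prop) :
  (forall v u t4 st, rev w = v ++ u -> runb tm (Some ([::], st0)) v = Some (t4, st) ->
     szok tm n V st /\ size t4 < 4) ->
  match parseb tm w return Prop with
  | Some ts => Q (regs [::] ts.1 ts.2)
  | None => okfail Q [::]
  end ->
  wp (loopp tm) Q (regs (digs (rev w)) [::] st0).
Proof.
move=> Hsz HQ; rewrite -runb_rev in HQ.
apply: (loopP (I := fun l s => exists v u, [/\ rev w = v ++ u, l = digs u, s rIN = l &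
  match runb tm (Some ([::], st0)) v return Prop with
  | Some ts => s = regs l ts.1 ts.2
  | None => s rBAD = [:: E1]
  end])).
- by exists [::], (rev w).
- move=> s Es [v [[|? ?] [//= Ev _ _]]]; rewrite cats0 in Ev; rewrite -Ev.
  case: runb HQ => [ts|] HQ; first by move=> ->.
  by move=> Hb; apply: HQ.
move=> x l s Es [v [[|a u] [//= Ev [-> El] _ Hv]]].
have Ev' : rev w = rcons v a ++ u by rewrite cat_rcons.
have Er : runb tm (Some ([::], st0)) (rcons v a)
    = obind (stepb tm ^~ a) (runb tm (Some ([::], st0)) v).
  by rewrite /runb -cats1 foldl_cat.
rewrite caseE; have Hsz' := Hsz _ _ _ _ Ev.
case E: (runb tm (Some ([::], st0)) v) Er Hv Hsz' => [[t4 st]|] Er Hv Hsz'.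
  have [Hs H4] := Hsz' _ _ erefl; rewrite {}Hv.
  have -> : sset (regs (dgs a :: l) t4 st) rIN l rBAD = [::] by [].
  have -> : sset (sset (regs (dgs a :: l) t4 st) rIN l) rBAD (behead [::]) = regs l t4 st.
    by st_eq.
  apply: (wp_bitp H4 Hs); rewrite -[stepb _ _ _]/(obind (stepb tm ^~ a) (Some (t4, st))) -Er.
  case E1: (runb tm _ (rcons v a)) => [ts|].
    by split=> //; exists (rcons v a), u; rewrite El E1.
  move=> s' Hb Ei; split=> //.
  by exists (rcons v a), u; rewrite E1 Ei El.
have Eb : sset s rIN l rBAD = s rBAD by [].
rewrite {}Eb Hv pushE sset_eq; split; first by rewrite /=; lia.
by split=> //; exists (rcons v a), u; rewrite El Er.
Qed.

Definition finalp : sprog :=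
  Case rBAD (fun o => if o is Some _ then clearp rACC else
  Case rT4 (fun o => if o is Some _ then Skip _ _ else
  Case rMODE (fun o => if symm o is Mout then
    Seq (ckmove rKEY (Skip _ _)) (Case rBAD (fun o =>
      if o is Some _ then clearp rACC else
      Seq lookup (Case rRES (fun o => if o is Some _ then
        Seq (mvp rRES rX) (Seq (copyp rBV rY) (Seq cmp (Case rF (fun o =>
          if o is Some _ then Skip _ _ else Push rACC E1)))) else Skip _ _))))
    else Skip _ _))).

Lemma wp_finalp tm n V t4 st : szok tm n V st -> size (bv st) <= n ->
  wp finalp (fun s => s rACC <> [::] <-> nilp t4 && accept st) (regs [::] t4 st).
Proof.
move=> [_ He Hbf _ [HnV HB]] Hbv; rewrite /finalp caseE [ohead _]/= [behead _]/=.
have -> : sset (regs [::] t4 st) rBAD [::] = regs [::] t4 st by st_eq.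
rewrite caseE; case: t4 => [|a t4]; rewrite [ohead _]/= [behead _]/=; last by rewrite skipE; split.
have -> : sset (regs [::] [::] st) rT4 [::] = regs [::] [::] st by st_eq.
rewrite caseE; have -> : regs [::] [::] st rMODE = mreg (md st) by [].
rewrite mregK; case: st He Hbf HB Hbv => m bf lb pr qr bv en /= He Hbf HB Hbv.
case: m; try by rewrite skipE; split.
rewrite seqE; apply: (wp_ckmove (bf := bf)) => //; first by lia.
case: canon; last first.
  by move=> s Eb Ei; rewrite caseE Eb; apply: wp_clear; split.
rewrite skipE caseE [ohead _]/= [behead _]/= seqE.
apply: (wp_lookup (k := rev bf) (e := en)) => //; first by rewrite size_rev; lia.
rewrite caseE sset_eq; case L: (lk en (rev bf)) => [[v|]|]; rewrite [ohead _]/= [behead _]/=;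
  try by rewrite skipE; split.
have Hv := lk_envok He L; rewrite /= in Hv.
rewrite seqE; apply: (wp_mv20 (u := digs v)) => //; first by rewrite size_map; lia.
rewrite seqE; apply: (wp_copy0 (u := digs bv)) => //; first by rewrite size_map; lia.
rewrite seqE; apply: (wp_cmp (x := v) (y := bv)) => //; first by lia.
rewrite caseE sset_eq; case: bne; rewrite [ohead _]/= [behead _]/=.
  by rewrite skipE; split.
by rewrite pushE; split; [rewrite /=; lia | split].
Qed.

Definition mcprog (tm : bool) : sprog := Seq (loopp tm) finalp.

Lemma wp_mcprog tm n V w :
  (forall v u t4 st, rev w = v ++ u -> runb tm (Some ([::], st0)) v = Some (t4, st) ->
     [/\ szok tm n V st, size (bv st) <= n & size t4 < 4]) ->
  wp (mcprog tm) (fun s => s rACC <> [::] <-> decide tm w) (input_state rIN dgs w).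
Proof.
move=> Hsz.
have -> : input_state rIN dgs w = regs (digs (rev w)) [::] st0.
  apply: functional_extensionality => r; rewrite /input_state.
  by case: eqP => [->|]; [rewrite /= map_rev | case: r].
rewrite /mcprog seqE; apply: (@wp_loopp tm n V).
  by move=> v u t4 st Ew Er; have [? _ ?] := Hsz _ _ _ _ Ew Er.
rewrite /decide; have := Hsz (rev w) [::]; rewrite cats0 runb_rev.
case: parseb => [[t4 st]|] H; last first.
  by move=> s Eb _; rewrite /finalp caseE Eb; apply: wp_clear; split.
have [Hs Hb _] := H _ _ erefl erefl.
apply: wp_mono (wp_finalp t4 Hs Hb) => s.
by case: (t4).
Qed.

End Subroutines.

(** * Sizes *)

(* Sizes of the values after reading [k] bits: an addition adds one bit, a
   multiplication at most quadruples the length. *)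
Definition vb (tm : bool) (k : nat) : nat := if tm then 4 ^ k else k.

Lemma leq_vb tm k : k <= vb tm k.
Proof. by case: tm => //=; apply: ltnW; apply: ltn_expl. Qed.

Lemma vb_step tm k : (if tm then 3 * vb tm k + 1 else (vb tm k).+1) <= vb tm k.+1.
Proof.
case: tm => //=; rewrite expnS; have : 0 < 4 ^ k by rewrite expn_gt0.
by lia.
Qed.

Lemma vb_mono tm : {homo vb tm : i j / i <= j}.
Proof. by move=> i j ij; case: tm => //=; rewrite leq_exp2l. Qed.

(** After [k] bits all numbers read, and the table itself, have at most [k] entries; only computed
    values need the larger bound [vb]. *)
Definition stok (tm : bool) (k : nat) (s : st) : Prop :=
  [/\ lbok tm (lb s) /\ size (bf s) <= k, size (pr s) <= k /\ size (qr s) <= k,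
       size (bv s) <= k, size (en s) <= k & envok k (vb tm k) (en s)].

Lemma envok_mono tm k k' e : k <= k' -> envok k (vb tm k) e -> envok k' (vb tm k') e.
Proof.
move=> kk; apply: sub_all => nx /andP[H1 H2]; rewrite (leq_trans H1 kk) /=.
exact: leq_trans H2 (vb_mono tm kk).
Qed.

Lemma stok_mono tm k k' s : k <= k' -> stok tm k s -> stok tm k' s.
Proof.
move=> kk [[H1 H2] [H3 H4] H5 H6 H7].
have L x : x <= k -> x <= k' by move=> h; apply: leq_trans h kk.
by do !split; rewrite ?L //; apply: envok_mono H7.
Qed.

(** One symbol completes at most one gate, so the growth of a single operation is charged to the
    step from [k] to [k.+1]. *)
Lemma close_stok tm k m s s' : stok tm k s -> close m s = Some s' -> stok tm k.+1 s'.
Proof.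
case: s => md bf lb pr qr bv en [/= [H1 H2] [H3 H4] H5 H6 H7].
rewrite /close /=; case: ifP => // _; rewrite /fin.
case: (lk en _) => //.
have H7' := envok_mono (leqnSn k) H7.
have bfk : size (rev bf) <= k.+1 by rewrite size_rev leqW.
case: lb H1 => [|[|||||o] [|y lb]] //= Ho.
  case=> <-; split; rewrite //= ?H7' ?bfk ?leqW //=.
  by rewrite andbT; apply: leq_trans (leq_vb _ _); rewrite leqW.
case L1: lk => [u|] //; case L2: lk => [r|] //= [<-].
split; rewrite //= ?H7' ?bfk ?leqW //= ?andbT.
apply: leq_trans (vb_step tm k).
exact: (size_opv Ho (leq_vb tm k) (lk_envok H7 L1) (lk_envok H7 L2)).
Qed.

Lemma step1_stok tm k s x s' : stok tm k s -> step1 tm s x = Some s' -> stok tm k.+1 s'.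
Proof.
move=> Hs; have Hs' := stok_mono (leqnSn k) Hs.
have PD b : putdig b s = Some s' -> stok tm k.+1 s'.
  rewrite /putdig; case: isdig => // -[<-].
  by case: Hs' Hs => [[? ?] ? ? ? ?] [[? ?] ? ? ? ?].
have CL m : close m s = Some s' -> stok tm k.+1 s' by apply: close_stok.
have rs : size (rev (bf s)) <= k.+1 by case: Hs' => -[_ ?] *; rewrite size_rev.
case: x; last move=> o.
all: case: s Hs' {Hs} PD CL rs => m bf lb pr qr bv en [[/= H1 H2] [/= H3 H4] /= H5 H6 H7] PD CL /= rs.
all: move=> E; try exact: PD E.
all: case: m PD CL E => PD CL // E; try (exact: CL E); move: E.
all: try (case: ifP => // Hc).
all: by case=> <-.
Qed.

Lemma stepb_stok tm k t4 s a t4' s' : stok tm k s -> stepb tm (t4, s) a = Some (t4', s') ->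
  stok tm k.+1 s'.
Proof.
move=> Hs; have Hs' := stok_mono (leqnSn k) Hs; rewrite /stepb.
case: t4 => [|b [|c [|d [|e t4]]]] /=;
  [by case=> _ <- | by case=> _ <- | by case=> _ <- | | by case=> _ <-].
case: dec4 => // x; case E: step1 => [s1|] //= [_ <-].
exact: step1_stok Hs E.
Qed.

Lemma runb_stok tm v t4 s : runb tm (Some ([::], st0)) v = Some (t4, s) ->
  stok tm (size v) s.
Proof.
elim/last_ind: v t4 s => [|v a IH] t4 s; first by case=> _ <-.
rewrite /runb -cats1 foldl_cat /= -/(runb tm _ v) cats1 size_rcons.
by case E: runb => [[t4' s1]|] //=; apply: stepb_stok (IH _ _ E).
Qed.

Lemma size_encenv n V e : envok n V e -> size (encenv e) <= size e * (n + V + 3).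
Proof.
elim: e => [|[m v] e IH] //= /andP[/andP[/= Hm Hv] /IH{}IH].
rewrite /encenv /= -/(encenv e) size_cat mulSn leq_add //.
rewrite /encent !size_cat /= size_cat !size_rev size_map /=.
by case: v Hv => [v|] /=; rewrite ?size_map; lia.
Qed.

(** At most n table entries of length n + V + 3 each, plus the working space demanded by [szok]. *)
Definition bound (tm : bool) (n : nat) : nat :=
  n * (n + vb tm n + 3) + 4 * vb tm n + n + 8.

Lemma wp_bound tm w :
  wpre (bound tm (size w)) (mcprog tm) (fun s => s rACC <> [::] <-> decide tm w)
     (input_state rIN dgs w).
Proof.
apply: (@wp_mcprog _ _ tm (size w) (vb tm (size w))).
  by rewrite /bound; lia.
move=> v u t4 st Ew Er.
have sv : size v <= size w by rewrite -[size w]size_rev Ew size_cat leq_addr.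
have [[H1 H2] [H3 H4] H5 H6 H7] := stok_mono sv (runb_stok Er).
split=> //.
  split=> //; split; first exact: leq_vb.
  rewrite /bound; set X := size w + _ + 3.
  have : size (en st) * X <= size w * X by rewrite leq_mul2r H6 orbT.
  by have := size_encenv H7; rewrite -/X; lia.
have : parseb tm (rev v) = Some (t4, st) by rewrite -runb_rev revK.
by case/parseb_sound=> t [].
Qed.

Lemma mc_decidable (O : op -> Prop) tm : (forall o, O o <-> alw tm o) ->
  exists (M : TM) K D, decides_in M (MC O) (fun n => K * (bound tm n).+1 ^ D).
Proof.
move=> HO; apply: (@prog_decides _ _ rIN rACC dgs (mcprog tm)) => w.
split; first by rewrite /bound; lia.
apply: wp_mono (wp_bound tm w) => s ->.
exact: decideP HO w.
Qed.

(** * From the height bound to P and E *)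

Lemma decides_in_le M L t t' : (forall n, t n <= t' n) ->
  decides_in M L t -> decides_in M L t'.
Proof. by move=> H HM w; have [k [Hk Hw]] := HM w; exists k; split=> //; apply: leq_trans (H _). Qed.

Lemma leq_expn m n e : m <= n -> m ^ e <= n ^ e.
Proof. by case: e => // e mn; rewrite leq_exp2r. Qed.

Lemma bound_poly K D : exists c, forall n, K * (bound false n).+1 ^ D <= c * n ^ c + c.
Proof.
set k := K * 36 ^ D; exists (k + 2 * D) => n; set c := k + 2 * D.
have kc : k <= c by rewrite leq_addr.
have Dc : 2 * D <= c by rewrite leq_addl.
(* For n = 0 the additive [c] is needed. For n > 0 the bound plus one is 2n^2 + 8n + 9, well below
   36n^2. *)
case: n => [|n].
  apply: leq_trans (leq_addl _ _); apply: leq_trans kc.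
  by rewrite leq_mul2l leq_expn ?orbT.
have Bn : (bound false n.+1).+1 <= 36 * n.+1 ^ 2.
  by rewrite /bound /= expnS expn1; nia.
apply: leq_trans (leq_addr _ _).
apply: (@leq_trans (k * n.+1 ^ (2 * D))).
  by rewrite -mulnA leq_mul2l expnM -expnMn leq_expn ?orbT.
by rewrite leq_mul // leq_pexp2l.
Qed.

Lemma bound_exp K D : exists c, forall n, K * (bound true n).+1 ^ D <= 2 ^ (c * n + c).
Proof.
exists (K + 5 * D) => n.
(* With y = 4^n and n <= y the left side is at most 2y^2 + 8y + 9, hence at most 32y^2, which is the
   right side. *)
have Bn : (bound true n).+1 <= 2 ^ (5 + 4 * n).
  have n4 := leq_vb true n; rewrite /bound.
  have E4 : vb true n = 2 ^ (2 * n) by rewrite expnM.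
  have -> : 2 ^ (5 + 4 * n) = 32 * (vb true n * vb true n).
    by rewrite E4 -expnD -[32]/(2 ^ 5) -expnD; congr (2 ^ _); lia.
  have : 0 < vb true n by rewrite expn_gt0.
  by move: (vb true n) n4 => y; nia.
apply: (@leq_trans (2 ^ K * (2 ^ (5 + 4 * n)) ^ D)).
  by apply: leq_mul; [apply: ltnW; apply: ltn_expl | apply: leq_expn].
by rewrite -expnM -expnD leq_exp2l //; nia.
Qed.

Theorem theorem2 :
  in_P (MC ops_cap_plus_div) /\ in_E (MC ops_cap_plus_times_div).
Proof.
split.
  have [|M [K [D HM]]] := @mc_decidable ops_cap_plus_div false.
    by rewrite /ops_cap_plus_div; case; split=> //; intuition congruence.
  have [c Hc] := bound_poly K D.
  by exists M, c; apply: decides_in_le HM.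
have [|M [K [D HM]]] := @mc_decidable ops_cap_plus_times_div true.
  by rewrite /ops_cap_plus_times_div; case; split=> //; intuition congruence.
have [c Hc] := bound_exp K D.
by exists M, c; apply: decides_in_le HM.
Qed.
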